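(* Let $M$ be a von Neumann algebra and let $\alpha:M\to M$ be a normal unit-preserving surjective $*$-endomorphism. For $n\ge 1$ let $c_n\in M$ be the central projection with $\ker\alpha^n=c_nM$, so that $c_1\le c_2\le\cdots$, and let $c=\lim_{n\to\infty}c_n$ (strong limit of the increasing sequence). Then $c$ is a central projection with $\alpha(c)=c$; the restriction $\beta$ of $\alpha$ to $P=(\mathbf 1-c)M$ is a $*$-automorphism of $P$; and $\alpha$ is conjugate to the endomorphism $$\beta\oplus\sigma_+: x\oplus y\in P\oplus\ell^\infty(\mathbb N,K)\mapsto \beta(x)\oplus\sigma_+(y)$$ of $P\oplus \ell^\infty(\mathbb N,K)$, where $K=\ker\alpha$ and $\sigma_+$ is the backward shift based on $K$.
   Context: $\mathbf 1$ denotes the unit of $M$. Zero von Neumann algebras are allowed. A weak$^*$-closed two-sided ideal of a von Neumann algebra $M$ has the form $zM$ for a unique central projection $z$, and is itself a von Neumann algebra with unit $z$. Conjugacy: endomorphisms $\alpha_1:M_1\to M_1$ and $\alpha_2:M_2\to M_2$ of von Neumann algebras are conjugate if there is a $*$-isomorphism $\theta:M_1\to M_2$ with $\theta\circ\alpha_1=\alpha_2\circ\theta$. Backward shift: for a von Neumann algebra $K$, $\ell^\infty(\mathbb N,K)$ is the von Neumann algebra of all norm-bounded sequences $(x_1,x_2,\dots)$ with $x_k\in K$ (coordinatewise operations), and the backward shift based on $K$ is the endomorphism $\sigma_+(x_1,x_2,x_3,\dots)=(x_2,x_3,\dots)$ of $\ell^\infty(\mathbb N,K)$. *)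

(* Defs.v *)
From HB Require Import structures.
From mathcomp Require Import all_boot all_order all_algebra.
From mathcomp Require Import sesquilinear complex interval_inference ring lra.
From mathcomp Require Import all_classical all_reals topology normedtype sequences.

Set Implicit Arguments.
Unset Strict Implicit.
Unset Printing Implicit Defensive.

Import Order.TTheory GRing.Theory Num.Theory.
Import numFieldNormedType.Exports.

Local Open Scope ring_scope.
Local Open Scope complex_scope.
Local Open Scope classical_set_scope.

(* The inner product is linear in its first argument and conjugate-linear in
   its second one. *)
HB.mixin Record isHilbert (R : realType) H of CompleteNormedModule R[i] H := {
  inner : {dot H for Num.conj} ;
  inner_normE : forall x : H, `|x| ^+ 2 = inner x x
}.

#[short(type="hilbertType")]
HB.structure Definition Hilbert (R : realType) :=
  { H of isHilbert R H & CompleteNormedModule R[i] H }.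

Section riesz.
Variables (R : realType) (H : hilbertType R).
Implicit Types (x y z : H) (t : R).

Lemma innerC x y : inner x y = (inner y x)^*.
Proof.
have := hermitian_subproof (s := inner) x y.
by rewrite expr0 mul1r.
Qed.

Lemma innerDl x y z : inner (x + y) z = inner x z + inner y z.
Proof. exact: linearDl. Qed.
Lemma innerDr x y z : inner z (x + y) = inner z x + inner z y.
Proof. exact: linearDr. Qed.
Lemma innerZl a x y : inner (a *: x) y = a * inner x y.
Proof. exact: linearZl_LR. Qed.
Lemma innerZr a x y : inner x (a *: y) = a^* * inner x y.
Proof. by rewrite innerC innerZl rmorphM /= -innerC. Qed.
Lemma inner0l x : inner 0 x = 0.
Proof. by rewrite -(scale0r x) innerZl mul0r. Qed.

Lemma inner0r x : inner x 0 = 0.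
Proof. by rewrite innerC inner0l conjc0. Qed.

Let rip x y : R := complex.Re (inner x y).

Let ripC x y : rip x y = rip y x.
Proof. by rewrite /rip innerC; case: (inner y x). Qed.
Let ripDl x y z : rip (x + y) z = rip x z + rip y z.
Proof. by rewrite /rip innerDl raddfD. Qed.
Let ripDr x y z : rip z (x + y) = rip z x + rip z y.
Proof. by rewrite !(ripC z) ripDl. Qed.
Let ripZl t x y : rip (t%:C *: x) y = t * rip x y.
Proof. by rewrite /rip innerZl; case: (inner x y) => a b /=; rewrite mul0r subr0. Qed.
Let ripZr t x y : rip x (t%:C *: y) = t * rip x y.
Proof. by rewrite !(ripC x) ripZl. Qed.
Let ripNl x y : rip (- x) y = - rip x y.
Proof. by rewrite -(scaleN1r x) -(rmorphN1 (real_complex R)) ripZl mulN1r. Qed.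
Let ripNr x y : rip x (- y) = - rip x y.
Proof. by rewrite !(ripC x) ripNl. Qed.
Let normE x : `|x| ^+ 2 = (rip x x)%:C.
Proof.
have /ger0_real : 0 <= inner x x by rewrite -inner_normE exprn_ge0.
rewrite inner_normE /rip; case: (inner x x) => a b.
by rewrite complex_real => /eqP /= ->.
Qed.
Let rip_ge0 x : 0 <= rip x x.
Proof. by rewrite -lecR -normE exprn_ge0. Qed.
Let rip_eq0 x : rip x x = 0 -> x = 0.
Proof. by move=> h; apply/eqP; rewrite -normr_eq0 -sqrf_eq0 normE h. Qed.
Let rip_CS x y : rip x y ^+ 2 <= rip x x * rip y y.
Proof.
have := rip_ge0 ((rip y y)%:C *: x - (rip x y)%:C *: y).
rewrite !(ripDl,ripDr,ripNl,ripNr,ripZl,ripZr) (ripC y x).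
have := rip_ge0 y; rewrite le_eqVlt => /orP[/eqP y0 _|y0].
  have /rip_eq0 -> : rip y y = 0 by rewrite -y0.
  by rewrite /rip !inner0r /= expr0n mulr0.
set a := rip x x; set b := rip x y; set c := rip y y => h.
have : 0 <= c * (a * c - b ^+ 2) by nra.
by rewrite pmulr_rge0 // subr_ge0.
Qed.


Lemma inner_CS x y : `|inner x y| <= `|x| * `|y|.
Proof.
rewrite -(@ler_pXn2r _ 2) ?nnegrE ?mulr_ge0 // exprMn !normE.
have := rip_CS ((inner x y)^* *: x) y.
have xxE : inner x x = (rip x x)%:C by rewrite -normE inner_normE.
have -> : rip ((inner x y)^* *: x) ((inner x y)^* *: x) =
    (complex.Re (inner x y) ^+ 2 + complex.Im (inner x y) ^+ 2) * rip x x.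
  by rewrite {1}/rip innerZl innerZr xxE; case: (inner x y) => a b /=; ring.
have -> : rip ((inner x y)^* *: x) y =
    complex.Re (inner x y) ^+ 2 + complex.Im (inner x y) ^+ 2.
  by rewrite /rip innerZl; case: (inner x y) => a b /=; ring.
rewrite -add_Re2_Im2 -rmorphM lecR.
have := rip_ge0 x; have := rip_ge0 y.
have := addr_ge0 (sqr_ge0 (complex.Re (inner x y))) (sqr_ge0 (complex.Im (inner x y))).
move: (_ + _) (rip x x) (rip y y) => n a b n0 b0 a0 h.
move: n0; rewrite le_eqVlt => /orP[/eqP <-|n0]; first by rewrite mulr_ge0.
by rewrite -(ler_pM2l n0) -expr2 mulrA.
Qed.

Lemma inner_injr y z : (forall x, inner x y = inner x z) -> y = z.
Proof.
move=> yz; apply/eqP; rewrite -subr_eq0 -normr_eq0 -sqrf_eq0 inner_normE.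
by rewrite innerDr -scaleN1r innerZr rmorphN1 mulN1r yz subrr.
Qed.

Lemma riesz (f : H -> R[i]) (r : R) :
  (forall a x y, f (a *: x + y) = a * f x + f y) ->
  (forall x, `|f x| <= r%:C * `|x|) ->
  exists z, forall x, f x = inner x z.
Proof.
move=> flin fb.
have f0 : f 0 = 0.
  by have := flin (-1) 0 0; rewrite scaler0 addr0 mulN1r addNr.
have fD x y : f (x + y) = f x + f y.
  by have := flin 1 x y; rewrite scale1r mul1r.
have fZ a x : f (a *: x) = a * f x by have := flin a x 0; rewrite f0 !addr0.
pose g x := complex.Re (f x).
have gD x y : g (x + y) = g x + g y by rewrite /g fD raddfD.
have gZ t x : g (t%:C *: x) = t * g x.
  by rewrite /g fZ; case: (f x) => a b /=; rewrite mul0r subr0.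
have gb x : g x ^+ 2 <= r ^+ 2 * rip x x.
  have rE : (r ^+ 2 * rip x x)%:C = (r%:C * `|x|) ^+ 2.
    by rewrite exprMn normE -rmorphXn -rmorphM.
  rewrite -lecR rE rmorphXn /=.
  have -> : (g x)%:C ^+ 2 = `|g x|%:C ^+ 2.
    by rewrite -!rmorphXn /= real_normK ?num_real.
  have h := le_trans (normc_ge_Re (f x)) (fb x).
  by rewrite lerXn2r // nnegrE ?(le_trans _ h) // ler0c.
pose q x := rip x x - 2 * g x.
have q_ge x : - r ^+ 2 <= q x.
  have := gb x; have := rip_ge0 x; rewrite /q.
  move: (rip x x) (g x) (sqr_ge0 r); move: (r ^+ 2) => s n u s0 n0 h.
  have [u0|u0] := leP u 0; first by lra.
  suff : 2 * u <= n + s by lra.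
  rewrite -(@ler_pXn2r _ 2) ?nnegrE; [|by []|by lra|by lra].
  by have := sqr_ge0 (n - s); rewrite !expr2 in h *; lra.
have q_inf : has_inf (range q).
  by split; [exists (q 0), 0|exists (- r ^+ 2) => _ [x _ <-]].
pose m := inf (range q).
have m_le x : m <= q x by apply: ge_inf; [exact: q_inf.2|exists x].
have /choice[x xP] : forall n : nat, exists x, q x < m + n.+1%:R^-1.
  move=> n; have e0 : 0 < n.+1%:R^-1 :> R by rewrite invr_gt0.
  by have [_ [x _ <-] ?] := inf_adherent e0 q_inf; exists x.
have xB n k : rip (x n - x k) (x n - x k) <= 2 * (n.+1%:R^-1 + k.+1%:R^-1).
  have := xP n; have := xP k; have := m_le (2^-1%:C *: (x n + x k)).
  rewrite /q gZ gD !(ripDl,ripDr,ripNl,ripNr,ripZl,ripZr) (ripC (x k) (x n)).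
  move: (n.+1%:R^-1) (k.+1%:R^-1) => a b.
  by move: (rip _ _) (rip (x n) _) (rip _ _) (g _) (g _) => *; lra.
have small (d : R) : 0 < d -> \forall n \near \oo, n.+1%:R^-1 < d.
  by move=> d0; exact: (near_infty_natSinv_lt (PosNum d0)).
have /cauchy_cvgP xcvg : cauchy (x @ \oo).
  apply/cauchyP => e e0.
  have [e' e'0 eE] : exists2 e' : R, 0 < e' & e = e'%:C.
    case: e e0 => a b; rewrite ltcE /= => /andP[/eqP -> a0].
    by exists a.
  have d0 : 0 < e' ^+ 2 / 4 by rewrite divr_gt0 ?exprn_gt0.
  have [N _ NP] := small _ d0.
  exists (x N); exists N => // n /= Nn.
  rewrite -ball_normE /= -(@ltr_pXn2r _ 2) ?nnegrE ?(ltW e0) //.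
  rewrite normE eE -rmorphXn ltcR.
  have := xB N n; have := NP N (leqnn N); have := NP n Nn => /=.
  move: (rip _ _) (N.+1%:R^-1) (n.+1%:R^-1) (e' ^+ 2) => p a b d *; lra.
move: xcvg => /cvg_ex[z xz].
have near_z (d : R) : 0 < d ->
    exists n, n.+1%:R^-1 < d /\ rip (z - x n) (z - x n) < d.
  move=> d0; have e0 : 0 < (Num.sqrt d)%:C by rewrite ltcR sqrtr_gt0.
  move/cvgrPdist_lt : xz => /(_ _ e0) xz.
  have [n [nd zd]] := filter_ex (filterI (small _ d0) xz).
  exists n; split => //.
  by move: zd; rewrite -(@ltr_pXn2r _ 2) ?nnegrE ?(ltW e0) // normE -rmorphXn
    ltcR sqr_sqrtr // ltW.
have gz y : g y = rip y z.
  have bound n : (rip (x n) y - g y) ^+ 2 <= n.+1%:R^-1 * rip y y.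
    have h t : 0 <= n.+1%:R^-1 + 2 * t * (rip (x n) y - g y) + t ^+ 2 * rip y y.
      have := xP n; have := m_le (x n + t%:C *: y).
      rewrite /q gD gZ !(ripDl,ripDr,ripZl,ripZr) (ripC y (x n)).
      by move: (n.+1%:R^-1) (rip _ _) (rip _ _) => a b c *; nra.
    have := rip_ge0 y; rewrite le_eqVlt => /orP[/eqP y0|y0].
      have /rip_eq0 -> : rip y y = 0 by rewrite -y0.
      by rewrite /rip /g f0 !inner0r /= subr0 expr0n mulr0.
    have := h (- (rip (x n) y - g y) / rip y y).
    move: (rip (x n) y - g y) y0 => a; move: (rip y y) (n.+1%:R^-1) => c b c0.
    have -> : b + 2 * (- a / c) * a + (- a / c) ^+ 2 * c = (b * c - a ^+ 2) / c.
      by field; rewrite gt_eqF.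
    by rewrite pmulr_lge0 ?invr_gt0 // subr_ge0.
  apply/eqP; rewrite eq_sym -subr_eq0 -sqrf_eq0 eq_le sqr_ge0 andbT leNgt.
  apply/negP => w0; set w := (_ ^+ 2) in w0.
  have c0 := rip_ge0 y.
  have d0 : 0 < w / (4 * rip y y + 1) by rewrite divr_gt0 //; lra.
  have [n [n1 n2]] := near_z _ d0.
  have h1 := bound n.
  have h2 := rip_CS (z - x n) y; rewrite ripDl ripNl in h2.
  have h3 : w <= 2 * (n.+1%:R^-1 + rip (z - x n) (z - x n)) * rip y y.
    rewrite /w (ripC y z); move: (rip (z - x n) _) (n.+1%:R^-1) h1 h2.
    move: (rip z y) (rip (x n) y) (g y) (rip y y) => s t v p b d h1 h2.
    have -> : s - v = (s - t) + (t - v) by ring.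
    move: (s - t) (t - v) h2 h1 => e k h2 h1.
    by have := sqr_ge0 (e - k); rewrite !expr2 in h1 h2 *; lra.
  have h4 : w / (4 * rip y y + 1) * (4 * rip y y + 1) = w.
    by rewrite divfK // gt_eqF //; lra.
  move: n1 n2 h3 h4; set d := w / _ => n1 n2 h3 h4.
  rewrite -/d in d0.
  have : 2 * (n.+1%:R^-1 + rip (z - x n) (z - x n)) * rip y y <= 4 * d * rip y y.
    rewrite ler_wpM2r //; clearbody d; move: n1 n2.
    by move: (n.+1%:R^-1) (rip (z - x n) _) => *; lra.
  move/(le_trans h3); clearbody d w; move: (rip y y) h4 d0 => c h4 d0 h5.
  by suff : d <= 0; [rewrite leNgt d0|lra].
exists z => y.
have := gz y; have := gz ('i *: y); rewrite /g /rip fZ innerZl.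
case: (f y) (inner y z) => a b [c e] /=.
by rewrite !mul0r !mul1r !sub0r => /oppr_inj -> ->.
Qed.

End riesz.

(* Unital complex *-algebras, possibly zero: as lalgType requires a nonzero
   ring, the scalar multiplication is part of this structure. *)
HB.mixin Record isStarAlgebra (C : numClosedFieldType) A of GRing.PzRing A := {
  ascale : C -> A -> A ;
  ascaleA : forall a b x, ascale a (ascale b x) = ascale (a * b) x ;
  ascale1 : left_id 1 ascale ;
  ascaleDr : right_distributive ascale +%R ;
  ascaleDl : forall x, {morph ascale^~ x : a b / a + b} ;
  ascaleAl : forall a (x y : A), ascale a (x * y) = ascale a x * y ;
  ascaleAr : forall a (x y : A), ascale a (x * y) = x * ascale a y ;
  star : A -> A ;
  starK : involutive star ;
  starD : {morph star : x y / x + y} ;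
  starZ : forall a x, star (ascale a x) = ascale (Num.conj a) (star x) ;
  starM : forall x y : A, star (x * y) = star y * star x
}.

#[short(type="starAlgType")]
HB.structure Definition StarAlgebra (C : numClosedFieldType) :=
  { A of isStarAlgebra C A & GRing.PzRing A }.

Section star_prod.
Variables (C : numClosedFieldType) (A B : starAlgType C).
Local Notation AB := (A * B)%type.
Implicit Types (a b : C) (x y : AB).

Let pscale a x : AB := (ascale a x.1, ascale a x.2).
Let pscaleA a b x : pscale a (pscale b x) = pscale (a * b) x.
Proof. by congr pair; exact: ascaleA. Qed.
Let pscale1 : left_id 1 pscale.
Proof. by case=> x y; rewrite /pscale /= !ascale1. Qed.
Let pscaleDr : right_distributive pscale +%R.
Proof. by move=> a x y; congr pair; exact: ascaleDr. Qed.
Let pscaleDl x : {morph pscale^~ x : a b / a + b}.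
Proof. by move=> a b; congr pair; exact: ascaleDl. Qed.
Let pscaleAl a x y : pscale a (x * y) = pscale a x * y.
Proof. by congr pair; exact: ascaleAl. Qed.
Let pscaleAr a x y : pscale a (x * y) = x * pscale a y.
Proof. by congr pair; exact: ascaleAr. Qed.
Let pstar x : AB := (star x.1, star x.2).
Let pstarK : involutive pstar.
Proof. by case=> x y; rewrite /pstar /= !starK. Qed.
Let pstarD : {morph pstar : x y / x + y}.
Proof. by move=> x y; congr pair; exact: starD. Qed.
Let pstarZ a x : pstar (pscale a x) = pscale (Num.conj a) (pstar x).
Proof. by congr pair; exact: starZ. Qed.
Let pstarM x y : pstar (x * y) = pstar y * pstar x.
Proof. by congr pair; exact: starM. Qed.

HB.instance Definition _ := isStarAlgebra.Build C AB
  pscaleA pscale1 pscaleDr pscaleDl pscaleAl pscaleAr pstarK pstarD pstarZ pstarM.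
End star_prod.

Section star_fct.
Variables (C : numClosedFieldType) (T : Type) (A : starAlgType C).
Local Notation TA := (T -> A).
Implicit Types (a b : C) (x y : TA).

Let fscale a x : TA := fun t => ascale a (x t).
Let fscaleA a b x : fscale a (fscale b x) = fscale (a * b) x.
Proof. by apply/funext => t; exact: ascaleA. Qed.
Let fscale1 : left_id 1 fscale.
Proof. by move=> x; apply/funext => t; exact: ascale1. Qed.
Let fscaleDr : right_distributive fscale +%R.
Proof. by move=> a x y; apply/funext => t; exact: ascaleDr. Qed.
Let fscaleDl x : {morph fscale^~ x : a b / a + b}.
Proof. by move=> a b; apply/funext => t; exact: ascaleDl. Qed.
Let fscaleAl a x y : fscale a (x * y) = fscale a x * y.
Proof. by apply/funext => t; exact: ascaleAl. Qed.
Let fscaleAr a x y : fscale a (x * y) = x * fscale a y.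
Proof. by apply/funext => t; exact: ascaleAr. Qed.
Let fstar x : TA := fun t => star (x t).
Let fstarK : involutive fstar.
Proof. by move=> x; apply/funext => t; exact: starK. Qed.
Let fstarD : {morph fstar : x y / x + y}.
Proof. by move=> x y; apply/funext => t; exact: starD. Qed.
Let fstarZ a x : fstar (fscale a x) = fscale (Num.conj a) (fstar x).
Proof. by apply/funext => t; exact: starZ. Qed.
Let fstarM x y : fstar (x * y) = fstar y * fstar x.
Proof. by apply/funext => t; exact: starM. Qed.

HB.instance Definition _ := isStarAlgebra.Build C TA
  fscaleA fscale1 fscaleDr fscaleDl fscaleAl fscaleAr fstarK fstarD fstarZ fstarM.
End star_fct.

Record boundedOp (R : realType) (H : hilbertType R) := BoundedOp {
  bop_fun :> H -> H ;
  bop_linear : linear bop_fun ;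
  bop_bounded : exists r : R, forall u, `|bop_fun u| <= r%:C * `|u|
}.

Section bounded_operators.
Variables (R : realType) (H : hilbertType R).
Local Notation B := (boundedOp H).
Implicit Types x y z : B.

Lemma bopP x y : (forall u, x u = y u) -> x = y.
Proof.
case: x y => [f fl fb] [g gl gb] /= /funext fg.
by rewrite -fg in gl gb *; congr BoundedOp; exact: Prop_irrelevance.
Qed.

Lemma bopD x u v : x (u + v) = x u + x v.
Proof. by have := bop_linear x 1 u v; rewrite !scale1r. Qed.
Lemma bop0 x : x 0 = 0.
Proof. by apply: (@addrI _ (x 0)); rewrite -bopD !addr0. Qed.
Lemma bopZ x a u : x (a *: u) = a *: x u.
Proof. by have := bop_linear x a u 0; rewrite bop0 !addr0. Qed.

Lemma bop_bounded_ge0 x :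
  exists2 r : R, 0 <= r & forall u, `|x u| <= r%:C * `|u|.
Proof.
have [r xr] := bop_bounded x; exists `|r| => // u.
by apply: le_trans (xr u) _; rewrite ler_wpM2r // lecR ler_norm.
Qed.

HB.instance Definition _ := gen_eqMixin B.
HB.instance Definition _ := gen_choiceMixin B.

Program Definition zero_bop : B := @BoundedOp _ _ (fun=> 0) _ _.
Next Obligation. by move=> a u v; rewrite scaler0 addr0. Qed.
Next Obligation. by exists 0 => u; rewrite normr0 mul0r. Qed.

Program Definition one_bop : B := @BoundedOp _ _ id _ _.
Next Obligation. by []. Qed.
Next Obligation. by exists 1 => u; rewrite mul1r. Qed.

Program Definition scale_bop a x : B := @BoundedOp _ _ (fun u => a *: x u) _ _.
Next Obligation.
by move=> a x b u v; rewrite bop_linear scalerDr !scalerA mulrC.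
Qed.
Next Obligation.
move=> a x; have [r xr] := bop_bounded x; exists (complex.Re `|a| * r) => u.
have -> : (complex.Re `|a| * r)%:C = `|a| * r%:C.
  by rewrite -[in RHS](RRe_real (normr_real a)) -rmorphM.
by rewrite normrZ -mulrA ler_wpM2l.
Qed.

Program Definition add_bop x y : B := @BoundedOp _ _ (fun u => x u + y u) _ _.
Next Obligation.
by move=> x y a u v; rewrite !bop_linear scalerDr addrACA.
Qed.
Next Obligation.
move=> x y; have [r xr] := bop_bounded x; have [s ys] := bop_bounded y.
exists (r + s) => u; rewrite rmorphD mulrDl.
by apply: le_trans (ler_normD _ _) _; rewrite lerD.
Qed.

Program Definition mul_bop x y : B := @BoundedOp _ _ (fun u => x (y u)) _ _.
Next Obligation. by move=> x y a u v; rewrite !bop_linear. Qed.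
Next Obligation.
move=> x y; have [r r0 xr] := bop_bounded_ge0 x; have [s ys] := bop_bounded y.
exists (r * s) => u; rewrite rmorphM -mulrA.
by apply: le_trans (xr _) _; rewrite ler_wpM2l // ler0c.
Qed.

Let opp_bop x := scale_bop (-1) x.

Let addA : associative add_bop.
Proof. by move=> x y z; apply: bopP => u; exact: addrA. Qed.
Let addC : commutative add_bop.
Proof. by move=> x y; apply: bopP => u; exact: addrC. Qed.
Let add0 : left_id zero_bop add_bop.
Proof. by move=> x; apply: bopP => u; exact: add0r. Qed.
Let addN : left_inverse zero_bop opp_bop add_bop.
Proof. by move=> x; apply: bopP => u /=; rewrite scaleN1r addNr. Qed.
HB.instance Definition _ := GRing.isZmodule.Build B addA addC add0 addN.

Let mulA : associative mul_bop.
Proof. by move=> x y z; exact: bopP. Qed.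
Let mul1 : left_id one_bop mul_bop.
Proof. by move=> x; exact: bopP. Qed.
Let mulx1 : right_id one_bop mul_bop.
Proof. by move=> x; exact: bopP. Qed.
Let mulDl : left_distributive mul_bop +%R.
Proof. by move=> x y z; exact: bopP. Qed.
Let mulDr : right_distributive mul_bop +%R.
Proof. by move=> x y z; apply: bopP => u; exact: bopD. Qed.
HB.instance Definition _ :=
  GRing.Zmodule_isPzRing.Build B mulA mul1 mulx1 mulDl mulDr.

Let scaleA a b x : scale_bop a (scale_bop b x) = scale_bop (a * b) x.
Proof. by apply: bopP => u; exact: scalerA. Qed.
Let scale1 : left_id 1 scale_bop.
Proof. by move=> x; apply: bopP => u; exact: scale1r. Qed.
Let scaleDr : right_distributive scale_bop +%R.
Proof. by move=> a x y; apply: bopP => u; exact: scalerDr. Qed.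
Let scaleDl x : {morph scale_bop^~ x : a b / a + b}.
Proof. by move=> a b; apply: bopP => u; exact: scalerDl. Qed.
Lemma adjoint_exists x : exists y : B, forall u v, inner (x u) v = inner u (y v).
Proof.
have [r r0 xr] := bop_bounded_ge0 x.
have /choice[f fP] : forall v, exists w, forall u, inner (x u) v = inner u w.
  move=> v; apply: (@riesz _ _ (fun u => inner (x u) v) (r * complex.Re `|v|)).
    by move=> a u w; rewrite bop_linear innerDl innerZl.
  move=> u; have -> : (r * complex.Re `|v|)%:C = r%:C * `|v|.
    by rewrite -[in RHS](RRe_real (normr_real v)) -rmorphM.
  rewrite mulrAC.
  by apply: le_trans (inner_CS _ _) _; rewrite ler_wpM2r.
have fl : linear f.
  move=> a v w; apply: inner_injr => u.
  by rewrite innerDr innerZr -!fP innerDr innerZr.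
have fb : exists r : R, forall u, `|f u| <= r%:C * `|u|.
  exists r => v; have [->|fv0] := eqVneq (f v) 0.
    by rewrite normr0 mulr_ge0 // ler0c.
  have n0 : 0 < `|f v| by rewrite normr_gt0.
  rewrite -(ler_pM2l n0) -expr2 inner_normE -fP.
  have ge0 : 0 <= inner (x (f v)) v by rewrite fP -inner_normE exprn_ge0.
  rewrite -(ger0_norm ge0); apply: le_trans (inner_CS _ _) _.
  by rewrite mulrA (mulrC `|f v|) ler_wpM2r.
by exists (BoundedOp fl fb).
Qed.

Definition adjoint x : B := projT1 (cid (adjoint_exists x)).
Lemma adjointP x u v : inner (x u) v = inner u (adjoint x v).
Proof. exact: (projT2 (cid (adjoint_exists x))). Qed.

Let adjoint_uniq x y :
  (forall u v, inner (x u) v = inner u (y v)) -> adjoint x = y.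
Proof. by move=> h; apply: bopP => v; apply: inner_injr => u; rewrite -adjointP. Qed.

Let scaleAl a x y : scale_bop a (x * y) = scale_bop a x * y.
Proof. exact: bopP. Qed.
Let scaleAr a x y : scale_bop a (x * y) = x * scale_bop a y.
Proof. by apply: bopP => u /=; rewrite bopZ. Qed.
Let adjointK : involutive adjoint.
Proof.
move=> x; apply: adjoint_uniq => u v.
by rewrite innerC -adjointP -innerC.
Qed.
Let adjointD : {morph adjoint : x y / x + y}.
Proof.
by move=> x y; apply: adjoint_uniq => u v; rewrite innerDl innerDr !adjointP.
Qed.
Let adjointZ a x : adjoint (scale_bop a x) = scale_bop (Num.conj a) (adjoint x).
Proof.
apply: adjoint_uniq => u v.
rewrite innerZl innerZr adjointP; congr (_ * _).
by rewrite -[LHS](conjcK a).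
Qed.
Let adjointM x y : adjoint (x * y) = adjoint y * adjoint x.
Proof.
apply: adjoint_uniq => u v.
by rewrite -[LHS]/(inner (x (y u)) v) !adjointP.
Qed.

HB.instance Definition _ := isStarAlgebra.Build R[i] B
  scaleA scale1 scaleDr scaleDl scaleAl scaleAr adjointK adjointD adjointZ adjointM.

End bounded_operators.

Section star_maps.
Variables (C : numClosedFieldType) (E F : starAlgType C).

(* Maps between *-subalgebras A of E and B of F are represented by total
   functions E -> F, of which only the values on A matter. *)
Definition star_homomorphism (A : set E) (B : set F) (f : E -> F) :=
  [/\ set_fun A B f,
      forall x y, A x -> A y -> f (x + y) = f x + f y,
      forall (a : C) x, A x -> f (ascale a x) = ascale a (f x),
      forall x y, A x -> A y -> f (x * y) = f x * f y &
      forall x, A x -> f (star x) = star (f x)].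

Definition star_isomorphism (A : set E) (B : set F) (f : E -> F) :=
  star_homomorphism A B f /\ set_bij A B f.

Definition conjugate (A : set E) (alpha : E -> E) (B : set F) (beta : F -> F) :=
  exists theta, star_isomorphism A B theta /\
    forall x, A x -> theta (alpha x) = beta (theta x).

Definition direct_sum_map (f : E -> E) (g : F -> F) (p : E * F) : E * F :=
  (f p.1, g p.2).

End star_maps.

Definition star_automorphism (C : numClosedFieldType) (E : starAlgType C)
  (A : set E) (f : E -> E) := star_isomorphism A A f.

Section von_neumann_algebras.
Variables (R : realType) (H : hilbertType R).
Local Notation B := (boundedOp H).
Implicit Types (M D : set B) (x y z : B).

Definition commutant M : set B := [set y | forall x, M x -> x * y = y * x].

Definition von_neumann_algebra M :=
  [/\ forall x y, M x -> M y -> M (x + y),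
      forall (a : R[i]) x, M x -> M (ascale a x),
      forall x y, M x -> M y -> M (x * y),
      forall x, M x -> M (star x) &
      commutant (commutant M) = M].

Definition positive x := forall u : H, 0 <= inner (x u) u.
Definition op_le x y := positive (y - x).

Definition directed D :=
  D !=set0 /\
  forall x y, D x -> D y -> exists z, [/\ D z, op_le x z & op_le y z].

(* For D consisting of positive operators, the upper bounds of D are positive,
   hence self-adjoint since H is complex. *)
Definition is_supremum M D x :=
  [/\ M x, forall y, D y -> op_le y x &
      forall z, M z -> (forall y, D y -> op_le y z) -> op_le x z].

Definition normal M (alpha : B -> B) :=
  forall D x, D `<=` M `&` positive -> directed D -> is_supremum M D x ->
    is_supremum M (alpha @` D) (alpha x).

Definition central_projection M z :=
  [/\ M z, z * z = z, star z = z & forall x, M x -> z * x = x * z].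

Definition ideal_of M z : set B := [set z * x | x in M].

Definition kernel M (alpha : B -> B) : set B := [set x | M x /\ alpha x = 0].

Definition strong_limit (x_ : nat -> B) x :=
  forall u : H, x_ n u @[n --> \oo] --> x u.

(* Sequences are indexed from 0. *)
Definition linfty (K : set B) : set (nat -> B) :=
  [set y | (forall k, K (y k)) /\
           exists r : R, forall k (u : H), `|y k u| <= r%:C * `|u|].

Definition backward_shift (y : nat -> B) : nat -> B := fun k => y k.+1.

End von_neumann_algebras.

(* Main.v *)
Require Import Defs.
From mathcomp Require Import all_boot all_order all_algebra.
From mathcomp Require Import complex ring lra.
From mathcomp Require Import all_classical all_reals topology normedtype.
From mathcomp Require Import sequences.

Set Implicit Arguments.
Unset Strict Implicit.
Unset Printing Implicit Defensive.

Import Order.TTheory GRing.Theory Num.Theory.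
Import numFieldNormedType.Exports.

Local Open Scope ring_scope.
Local Open Scope classical_set_scope.

(** The kernel projections [e n] of [alpha ^ n] increase, and [alpha] sends
    [e n.+1] to [e n], because both [e n] and [alpha (e n.+1)] generate the
    ideal [ker (alpha ^ n)] ([alpha_proj]). Their strong limit [c] is also their
    supremum, so normality of [alpha] gives [alpha c = c] ([alpha_limit]). Under
    [1 - c] the map [alpha] is injective, as its kernel lies under
    [e 1 <= c] ([corner_automorphism]). Under [c] the algebra splits along the
    orthogonal central projections [e k.+1 - e k], and [alpha ^ k] carries the
    [k]-th piece isomorphically onto [K = ker alpha]. Hence
    [x |-> ((1 - c) x, (e 1 alpha ^ k x)_k)] is the required conjugacy: applying
    [alpha] first replaces [k] by [k + 1] in the second coordinate.

    The analytic content is that this map has bounded sequences as values and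
    reaches all of them. Both rest on the equivalence of a norm bound on [x]
    with positivity of [r 1 - x^* x] ([sqbounded_positive]).
    - Normality, applied to the directed set [{0, x}], shows that [alpha]
      preserves positivity, hence does not increase norms
      ([normal_positive], [positive_contractive]).
    - Conversely, an element of [K] lifts to the [k]-th piece without increase
      of norm ([bounded_lift]): in a von Neumann algebra [r 1 - y^* y] is a
      square [s^* s] ([bounded_defect]), which lifts to a positive element
      [q^* q]. The lifts of a bounded sequence then sum up strongly, being
      supported on orthogonal projections ([bounded_gluing]).

    The square root is the limit of an increasing bounded sequence, as is [c];
    the convergence of such sequences is [monotone_strong_limit]. *)

(** * The real inner product and completeness *)

Section real_inner_product.
Local Open Scope complex_scope.
Variables (R : realType) (H : hilbertType R).
Implicit Types (u v w : H) (t : R).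

Definition rdot u v : R := complex.Re (inner u v).

Lemma rdotC u v : rdot u v = rdot v u.
Proof. by rewrite /rdot innerC; case: (inner v u). Qed.
Lemma rdotDl u v w : rdot (u + v) w = rdot u w + rdot v w.
Proof. by rewrite /rdot innerDl raddfD. Qed.
Lemma rdotDr u v w : rdot w (u + v) = rdot w u + rdot w v.
Proof. by rewrite !(rdotC w) rdotDl. Qed.
Lemma rdotZl t u v : rdot (t%:C *: u) v = t * rdot u v.
Proof.
by rewrite /rdot innerZl; case: (inner u v) => a b /=; rewrite mul0r subr0.
Qed.
Lemma rdotZr t u v : rdot u (t%:C *: v) = t * rdot u v.
Proof. by rewrite !(rdotC u) rdotZl. Qed.
Lemma rdotNl u v : rdot (- u) v = - rdot u v.
Proof. by rewrite -(scaleN1r u) -(rmorphN1 (real_complex R)) rdotZl mulN1r. Qed.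
Lemma rdotNr u v : rdot u (- v) = - rdot u v.
Proof. by rewrite !(rdotC u) rdotNl. Qed.
Lemma rdot0l u : rdot 0 u = 0.
Proof. by rewrite /rdot inner0l. Qed.

Definition rdotE := (rdotDl, rdotDr, rdotNl, rdotNr, rdotZl, rdotZr).

Definition sqnorm u := rdot u u.

Lemma normr_sqnorm u : `|u| ^+ 2 = (sqnorm u)%:C.
Proof.
have /ger0_real : 0 <= inner u u by rewrite -inner_normE exprn_ge0.
rewrite inner_normE /sqnorm /rdot; case: (inner u u) => a b.
by rewrite complex_real => /eqP /= ->.
Qed.

Lemma sqnorm_ge0 u : 0 <= sqnorm u.
Proof. by rewrite -lecR -normr_sqnorm exprn_ge0. Qed.

Lemma sqnorm_eq0 u : sqnorm u = 0 -> u = 0.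
Proof.
by move=> h; apply/eqP; rewrite -normr_eq0 -sqrf_eq0 normr_sqnorm h.
Qed.

Lemma sqnormN u : sqnorm (- u) = sqnorm u.
Proof. by rewrite /sqnorm rdotNl rdotNr opprK. Qed.

Lemma rdot_CS u v : rdot u v ^+ 2 <= sqnorm u * sqnorm v.
Proof.
have := sqnorm_ge0 ((sqnorm v)%:C *: u - (rdot u v)%:C *: v).
rewrite /sqnorm !rdotE (rdotC v u).
have := sqnorm_ge0 v; rewrite le_eqVlt => /orP[/eqP v0 _|v0].
  have /sqnorm_eq0 -> : sqnorm v = 0 by rewrite -v0.
  by rewrite rdotC !rdot0l mulr0 expr0n.
rewrite /sqnorm in v0.
set a := rdot u u; set b := rdot u v; set c := rdot v v => h.
have : 0 <= c * (a * c - b ^+ 2) by rewrite -/c in v0; nra.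
by rewrite pmulr_rge0 // subr_ge0.
Qed.

Lemma sqnormD_le u v : sqnorm (u + v) <= 2 * (sqnorm u + sqnorm v).
Proof.
have := sqnorm_ge0 (u - v); rewrite /sqnorm !rdotE (rdotC v u); lra.
Qed.

Lemma rdot_le_sqnorm u v : 2 * rdot u v <= sqnorm u + sqnorm v.
Proof.
have := sqnorm_ge0 (u - v); rewrite /sqnorm !rdotE (rdotC v u); lra.
Qed.

Lemma eq_of_rdot v w : (forall u, rdot u v = rdot u w) -> v = w.
Proof.
move=> vw; apply/eqP; rewrite -subr_eq0; apply/eqP/sqnorm_eq0.
by rewrite /sqnorm rdotDr rdotNr vw subrr.
Qed.

Lemma normr_le_sqnorm t u v : 0 <= t ->
  (`|u| <= t%:C * `|v|) = (sqnorm u <= t ^+ 2 * sqnorm v).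
Proof.
move=> t0; rewrite -(@ler_pXn2r _ 2) ?nnegrE ?mulr_ge0 ?ler0c //.
by rewrite exprMn !normr_sqnorm -rmorphXn -rmorphM lecR.
Qed.

Lemma cvg_sqnorm (v_ : nat -> H) v :
  (v_ n @[n --> \oo] --> v) <->
  forall e : R, 0 < e -> \forall n \near \oo, sqnorm (v - v_ n) < e.
Proof.
have lt_sq (d : R) u : 0 < d -> (`|u| < d%:C) = (sqnorm u < d ^+ 2).
  move=> d0; rewrite -(@ltr_pXn2r _ 2) ?nnegrE ?ler0c ?(ltW d0) //.
  by rewrite normr_sqnorm -rmorphXn ltcR.
split.
  move=> /cvgrPdist_lt vv e e0.
  have d0 : 0 < Num.sqrt e by rewrite sqrtr_gt0.
  have d0' : 0 < (Num.sqrt e)%:C by rewrite ltcR.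
  apply: filterS (vv _ d0') => n.
  by rewrite lt_sq // sqr_sqrtr // ltW.
move=> h; apply/cvgrPdist_lt => e e0.
have [d d0 ->] : exists2 d : R, 0 < d & e = d%:C.
  case: e e0 => a b; rewrite ltcE /= => /andP[/eqP -> a0].
  by exists a.
apply: filterS (h _ (exprn_gt0 2 d0)) => n.
by rewrite lt_sq.
Qed.

Lemma cvg_rdot (v_ : nat -> H) v u :
  v_ n @[n --> \oo] --> v -> rdot (v_ n) u @[n --> \oo] --> rdot v u.
Proof.
move=> /cvg_sqnorm vv; apply/cvgrPdist_lt => e e0.
have u0 := sqnorm_ge0 u.
have d0 : 0 < e ^+ 2 / (sqnorm u + 1) by rewrite divr_gt0 ?exprn_gt0 //; lra.
apply: filterS (vv _ d0) => n.
rewrite ltr_pdivlMr; last by lra.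
rewrite -rdotNl -rdotDl => h.
rewrite -(@ltr_pXn2r _ 2) ?nnegrE ?(ltW e0) // real_normK ?num_real //.
apply: le_lt_trans h; apply: le_trans (rdot_CS _ _) _.
by rewrite ler_wpM2l ?sqnorm_ge0 // lerDl.
Qed.

(** The bound on increments makes [f] nondecreasing, hence convergent, and
    carries the Cauchy property over from [f] to [v_]. *)
Lemma cvg_of_increments (v_ : nat -> H) (f : nat -> R) (B : R) :
  (forall m n, (m <= n)%N -> sqnorm (v_ n - v_ m) <= f n - f m) ->
  (forall n, f n <= B) ->
  exists v, v_ n @[n --> \oo] --> v.
Proof.
move=> vf fB.
have fcvg : cvgn f.
  apply: nondecreasing_is_cvgn.
    move=> m n mn; rewrite -subr_ge0.
    by apply: le_trans (vf _ _ mn); exact: sqnorm_ge0.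
  by exists B => _ [n _ <-].
suff /cauchy_cvgP /cvg_ex[v vv] : cauchy (v_ @ \oo) by exists v.
apply/cauchyP => e e0.
have [d d0 eE] : exists2 d : R, 0 < d & e = d%:C.
  case: e e0 => a b; rewrite ltcE /= => /andP[/eqP -> a0].
  by exists a.
have /cvgrPdist_lt /(_ (d ^+ 2 / 2)) fl := fcvg.
have [|N _ NP] := fl; first by rewrite divr_gt0 ?exprn_gt0.
exists (v_ N); exists N => // n /= Nn.
rewrite -ball_normE /= -(@ltr_pXn2r _ 2) ?nnegrE ?(ltW e0) //.
rewrite normr_sqnorm eE -rmorphXn ltcR.
rewrite -opprB sqnormN.
apply: le_lt_trans (vf _ _ Nn) _.
have /= := NP N (leqnn N); have /= := NP _ Nn.
by rewrite !ltr_norml => /andP[? ?] /andP[? ?]; lra.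
Qed.

End real_inner_product.
Arguments cvg_rdot {R H v_ v} u _.

(** * Bounded operators and strong limits *)

Section operators.
Local Open Scope complex_scope.
Variables (R : realType) (H : hilbertType R).
Local Notation B := (boundedOp H).
Implicit Types (x y z : B) (u v w : H) (r t : R).

Lemma bopN x u : (- x : B) u = - x u.
Proof. by rewrite -[LHS]/(-1 *: x u) scaleN1r. Qed.

Lemma bopB x y u : (x - y : B) u = x u - y u.
Proof. by rewrite -bopN. Qed.

Lemma bopS (a : R[i]) x u : (ascale a x : B) u = a *: x u.
Proof. by []. Qed.

Lemma bopM x y u : (x * y : B) u = x (y u).
Proof. by []. Qed.

Lemma bop_map_opp x u : x (- u) = - x u.
Proof. by rewrite -scaleN1r bopZ scaleN1r. Qed.

Lemma bop_map_sub x u v : x (u - v) = x u - x v.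
Proof. by rewrite bopD bop_map_opp. Qed.

Lemma bop_opp x : - x = ascale (-1) x.
Proof. by apply: bopP => u. Qed.

Lemma rdot_star x u v : rdot (x u) v = rdot u (star x v).
Proof. by rewrite /rdot adjointP. Qed.

Lemma starP x y : (forall u v, rdot (x u) v = rdot u (y v)) -> star x = y.
Proof.
move=> h; apply: bopP => v; apply: eq_of_rdot => u.
rewrite -rdot_star.
exact: h.
Qed.

Lemma rdot_sa x u v : star x = x -> rdot (x u) v = rdot u (x v).
Proof. by move=> sx; rewrite rdot_star sx. Qed.

Lemma starN x : star (- x) = - star x.
Proof. by rewrite !bop_opp starZ rmorphN1. Qed.

Lemma starB x y : star (x - y) = star x - star y.
Proof. by rewrite starD starN. Qed.

Lemma star0 : star (0 : B) = 0.
Proof. by have := starB 0 0; rewrite !subrr. Qed.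

Lemma star1 : star (1 : B) = 1.
Proof. by apply: starP. Qed.

Lemma star_realZ t x : star (ascale t%:C x) = ascale t%:C (star x).
Proof. by rewrite starZ; congr ascale; exact: conjc_real. Qed.

Lemma ascale0 x : ascale 0 x = 0.
Proof. by apply: bopP => u; exact: scale0r. Qed.

Lemma innerBl u v w : inner (u - v) w = inner u w - inner v w.
Proof. by rewrite innerDl -(scaleN1r v) innerZl mulN1r. Qed.

Lemma positiveE x : positive x <->
  forall u, complex.Im (inner (x u) u) = 0 /\ 0 <= rdot (x u) u.
Proof.
split=> h u; have := h u.
  rewrite /rdot; case: (inner _ _) => p q.
  by rewrite lecE /= => /andP[/eqP -> ->].
by rewrite /rdot; case: (inner _ _) => p q /= [-> p0]; rewrite lecE /= eqxx.
Qed.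

Lemma positive_rdot x u : positive x -> 0 <= rdot (x u) u.
Proof. by move=> /positiveE /(_ u) []. Qed.

Lemma selfadjoint_Im x u : star x = x -> complex.Im (inner (x u) u) = 0.
Proof.
move=> sx; have : inner (x u) u = (inner (x u) u)^*.
  by rewrite -innerC adjointP -[adjoint x]/(star x) sx.
by case: (inner (x u) u) => p q /= [qE]; lra.
Qed.

Lemma positiveP x : star x = x -> positive x <-> forall u, 0 <= rdot (x u) u.
Proof.
move=> sx; rewrite positiveE; split=> h u; first by have [] := h u.
by split; [exact: selfadjoint_Im|exact: h].
Qed.

Lemma positive_starM x : positive (star x * x).
Proof.
apply/positiveP; first by rewrite starM starK.
by move=> u; rewrite rdotC -rdot_star; exact: sqnorm_ge0.
Qed.

(** Norm bounds are stated for squared norms, that is [sqbounded r x] means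
    that [x] has norm at most the square root of [r]. *)
Definition sqbounded r x := forall u, sqnorm (x u) <= r * sqnorm u.

Lemma sqbounded_exists x : exists2 r, 0 < r & sqbounded r x.
Proof.
have [r r0 xr] := bop_bounded_ge0 x; exists (r ^+ 2 + 1) => [|u].
  by rewrite ltr_wpDl ?sqr_ge0.
have := xr u; rewrite normr_le_sqnorm // => /le_trans; apply.
by rewrite ler_wpM2r ?sqnorm_ge0 // lerDl.
Qed.

Lemma rdot_defect r x u : rdot ((ascale r%:C 1 - star x * x : B) u) u =
  r * sqnorm u - sqnorm (x u).
Proof.
rewrite bopB bopS rdotDl rdotZl rdotNl.
by rewrite [rdot ((star x * x : B) u) u]rdotC -rdot_star.
Qed.

(** This makes a unital map that preserves positivity and the operations
    contractive. *)
Lemma sqbounded_positive r x :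
  sqbounded r x <-> positive (ascale r%:C 1 - star x * x).
Proof.
split=> [h|h u].
  apply/positiveP; first by rewrite starB star_realZ star1 starM starK.
  by move=> u; rewrite rdot_defect subr_ge0.
by rewrite -subr_ge0 -rdot_defect; exact: positive_rdot.
Qed.

(** For positive [z] of norm at most [r], [z ^ 2 <= r z]: evaluate the form of
    [z] at [u - z u / r]. *)
Lemma positive_sqnorm_le z r u : star z = z -> positive z -> 0 < r ->
  sqbounded (r ^+ 2) z -> sqnorm (z u) <= r * rdot (z u) u.
Proof.
move=> sz zpos r0 zr; set v := z u.
have zvv : rdot (z v) v <= r * sqnorm v.
  have v0 : 0 <= r * sqnorm v by rewrite mulr_ge0 ?sqnorm_ge0 // ltW.
  rewrite -(@ler_pXn2r _ 2) ?nnegrE // ?positive_rdot //.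
  apply: le_trans (rdot_CS _ _) _.
  by rewrite exprMn [X in _ <= _ * X]expr2 mulrA ler_wpM2r ?sqnorm_ge0.
(* Expanding this form gives [rdot v u - 2 n / r + rdot (z v) v / r ^ 2] with
   [n = sqnorm v], and the last term is at most [n / r]. *)
have := positive_rdot (u - (r^-1)%:C *: v) zpos.
rewrite bop_map_sub bopZ -/v !rdotE.
have -> : rdot (z v) u = sqnorm v by rewrite rdot_sa.
rewrite -/(sqnorm v).
have ri : r^-1 * r = 1 by rewrite mulVf ?gt_eqF.
have ri0 : 0 < r^-1 by rewrite invr_gt0.
have h : r^-1 * (r^-1 * rdot (z v) v) <= r^-1 * sqnorm v.
  rewrite ler_wpM2l ?(ltW ri0) //.
  apply: le_trans (_ : r^-1 * (r * sqnorm v) <= _).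
    by rewrite ler_wpM2l ?(ltW ri0).
  by rewrite mulrA ri mul1r.
move=> h2.
have h3 : r^-1 * sqnorm v <= rdot v u by lra.
have := ler_wpM2l (ltW r0) h3.
by rewrite mulrA mulfV ?gt_eqF // mul1r.
Qed.

Lemma strong_limit_unique (x_ : nat -> B) x y :
  strong_limit x_ x -> strong_limit x_ y -> x = y.
Proof. by move=> hx hy; apply: bopP => u; exact: cvg_unique (hx u) (hy u). Qed.

Lemma strong_limit_cst x : strong_limit (fun=> x) x.
Proof. by move=> u; exact: cvg_cst. Qed.

Lemma strong_limitD (x_ y_ : nat -> B) x y :
  strong_limit x_ x -> strong_limit y_ y ->
  strong_limit (fun n => x_ n + y_ n) (x + y).
Proof. by move=> hx hy u; exact: cvgD (hx u) (hy u). Qed.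

Lemma strong_limitZ (a : R[i]) (x_ : nat -> B) x :
  strong_limit x_ x ->
  strong_limit (fun n => ascale a (x_ n)) (ascale a x).
Proof. by move=> hx u; exact: cvgZr (hx u). Qed.

Lemma strong_limit_mulr y (x_ : nat -> B) x : strong_limit x_ x ->
  strong_limit (fun n => x_ n * y) (x * y).
Proof. by move=> hx u; exact: hx (y u). Qed.

(** [x y - x_ n y_ n = (x - x_ n) y + x_ n (y - y_ n)], and the uniform bound
    on [x_] controls the second term. *)
Lemma strong_limitM r (x_ y_ : nat -> B) x y :
  (forall n, sqbounded r (x_ n)) ->
  strong_limit x_ x -> strong_limit y_ y ->
  strong_limit (fun n => x_ n * y_ n) (x * y).
Proof.
move=> xr hx hy u; apply/cvg_sqnorm => e e0.
have r0 : 0 < `|r| + 1 by rewrite ltr_wpDl.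
have d0 : 0 < e / 4 / (`|r| + 1) by rewrite !divr_gt0.
have /cvg_sqnorm /(_ (e / 4)) hx' := hx (y u).
have /cvg_sqnorm /(_ _ d0) hy' := hy u.
apply: filterS (filterI (hx' (divr_gt0 e0 (ltr0Sn R 3))) hy') => n [h1].
rewrite ltr_pdivlMr // => h2.
rewrite !bopM.
have -> : x (y u) - x_ n (y_ n u) =
    (x (y u) - x_ n (y u)) + x_ n (y u - y_ n u).
  by rewrite bop_map_sub addrA subrK.
apply: le_lt_trans (sqnormD_le _ _) _.
have h3 := xr n (y u - y_ n u).
have h4 := sqnorm_ge0 (y u - y_ n u).
have h5 := ler_norm r.
have := ler_wpM2r h4 h5; lra.
Qed.

Lemma strong_limit_mull y (x_ : nat -> B) x : strong_limit x_ x ->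
  strong_limit (fun n => y * x_ n) (y * x).
Proof.
have [r _ yr] := sqbounded_exists y.
by move=> hx; apply: (strong_limitM (r := r)) => //; exact: strong_limit_cst.
Qed.

Lemma strong_limit_sa (x_ : nat -> B) x : strong_limit x_ x ->
  (forall n, star (x_ n) = x_ n) -> star x = x.
Proof.
move=> hx sx; apply: starP => u v; rewrite [RHS]rdotC.
have E : (fun n => rdot (x_ n u) v) = (fun n => rdot (x_ n v) u).
  by apply/funext => n; rewrite rdot_sa // rdotC.
have h := cvg_rdot v (hx u); rewrite E in h.
exact: cvg_unique h (cvg_rdot u (hx v)).
Qed.

(** With [v] the limit of [x_ n u], the bound for [v] comes from the limit of
    [2 rdot (x_ n u) v <= sqnorm (x_ n u) + sqnorm v]. *)
Lemma strong_limit_exists r (x_ : nat -> B) :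
  0 <= r -> (forall n, sqbounded r (x_ n)) ->
  (forall u, exists v, x_ n u @[n --> \oo] --> v) ->
  exists2 x, strong_limit x_ x & sqbounded r x.
Proof.
move=> r0 xr /choice[f hf].
have fb u : sqnorm (f u) <= r * sqnorm u.
  suff : 2 * sqnorm (f u) <= r * sqnorm u + sqnorm (f u) by lra.
  have h : 2 * rdot (x_ n u) (f u) @[n --> \oo] --> 2 * sqnorm (f u).
    exact: cvgMr (cvg_rdot _ (hf u)).
  apply: (cvgr_to_le h); near=> n.
  by apply: le_trans (rdot_le_sqnorm _ _) _; rewrite lerD2r; exact: xr.
have fl : linear f.
  move=> a u v; apply: cvg_unique (hf _) _ => //.
  have -> : (fun n => x_ n (a *: u + v)) = (fun n => a *: x_ n u + x_ n v).
    by apply/funext => n; rewrite bopD bopZ.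
  by apply: cvgD => //; exact: cvgZr.
have fb' : exists t : R, forall u, `|f u| <= t%:C * `|u|.
  exists (Num.sqrt r) => u.
  by rewrite normr_le_sqnorm ?sqrtr_ge0 // sqr_sqrtr.
by exists (BoundedOp fl fb').
Unshelve. all: by end_near. Qed.

(** By [positive_sqnorm_le], applied to [x_ n - x_ m], the squared increments of
    [x_ n u] are controlled by those of the bounded quadratic forms
    [rdot (x_ n u) u]. *)
Lemma monotone_strong_limit r (x_ : nat -> B) : 0 < r ->
  (forall n, star (x_ n) = x_ n) -> (forall n, sqbounded (r ^+ 2) (x_ n)) ->
  (forall m n, (m <= n)%N -> op_le (x_ m) (x_ n)) ->
  exists2 x, strong_limit x_ x & sqbounded (r ^+ 2) x.
Proof.
move=> r0 sx xr xmono.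
apply: strong_limit_exists => //; first by rewrite exprn_ge0 // ltW.
move=> u; pose f n := 2 * r * rdot (x_ n u) u.
have r20 : 0 < 2 * r by rewrite mulr_gt0.
apply: (@cvg_of_increments _ _ _ f
  (2 * r * (2^-1 * (r ^+ 2 * sqnorm u + sqnorm u)))).
  move=> m n mn; rewrite /f -mulrBr -rdotNl -rdotDl -bopB.
  apply: positive_sqnorm_le; rewrite ?starB ?sx //; first exact: xmono.
  move=> v; rewrite bopB; apply: le_trans (sqnormD_le _ _) _.
  have := xr n v; have := xr m v.
  rewrite sqnormN exprMn; lra.
move=> n; rewrite ler_wpM2l ?(ltW r20) //.
have := rdot_le_sqnorm (x_ n u) u; have := xr n u; lra.
Qed.

End operators.

(** * Square roots of positive contractions *)

Section square_root.
Local Open Scope complex_scope.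
Variables (R : realType) (H : hilbertType R).
Local Notation B := (boundedOp H).
Implicit Types (x y z a b : B) (u v : H) (t : R).

Lemma ascale_half x : ascale (2^-1)%:C (x + x) = x.
Proof.
apply: bopP => u; rewrite -[LHS]/((2^-1)%:C *: (x u + x u)) scalerDr -scalerDl.
rewrite -rmorphD (_ : 2^-1 + 2^-1 = 1 :> R) ?scale1r //; lra.
Qed.

(** The polynomials in [a] with nonnegative coefficients. They commute, are
    closed under products, and are positive when [a] is; the iterates
    approximating the square root and their increments are of this kind. *)
Inductive power_cone a : B -> Prop :=
| power_cone1 : power_cone a 1
| power_coneZ t x : 0 <= t -> power_cone a x -> power_cone a (ascale t%:C x)
| power_coneD x y : power_cone a x -> power_cone a y -> power_cone a (x + y)
| power_coneM x : power_cone a x -> power_cone a (a * x).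

Lemma power_cone_id a : power_cone a a.
Proof. by rewrite -{2}(mulr1 a); apply: power_coneM; exact: power_cone1. Qed.

Lemma power_cone_comm a x y : power_cone a x -> a * y = y * a -> x * y = y * x.
Proof.
move=> ax ay; elim: ax => [|t {}x _ _ h|{}x z _ hx _ hz|{}x _ h].
- by rewrite mul1r mulr1.
- by rewrite -ascaleAl -ascaleAr h.
- by rewrite mulrDl mulrDr hx hz.
- by rewrite -mulrA h mulrA ay mulrA.
Qed.

Lemma power_coneC a x y : power_cone a x -> power_cone a y -> x * y = y * x.
Proof.
move=> ax ay; apply: power_cone_comm ax _.
by symmetry; apply: power_cone_comm ay _.
Qed.

Lemma power_cone_mul a x y :
  power_cone a x -> power_cone a y -> power_cone a (x * y).
Proof.
move=> ax ay; elim: ax => [|t {}x t0 _ h|{}x z _ hx _ hz|{}x _ h].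
- by rewrite mul1r.
- by rewrite -ascaleAl; exact: power_coneZ.
- by rewrite mulrDl; exact: power_coneD.
- by rewrite -mulrA; exact: power_coneM.
Qed.

Lemma power_cone_sa a x : star a = a -> power_cone a x -> star x = x.
Proof.
move=> sa; elim=> [|t {}x t0 _ h|{}x z _ hx _ hz|{}x ax h].
- exact: star1.
- by rewrite star_realZ h.
- by rewrite starD hx hz.
- by rewrite starM h sa; apply: power_cone_comm ax _.
Qed.

(** Even powers [a ^ 2k] have form [|a ^ k u| ^ 2], odd ones the form of [a] at
    [a ^ k u]; the induction therefore treats [x] and [a x] together. *)
Lemma power_cone_positive a x : star a = a -> positive a ->
  power_cone a x -> positive x.
Proof.
move=> sa apos ax; apply/positiveP; first exact: power_cone_sa ax.
suff h : forall u, 0 <= rdot (x u) u /\ 0 <= rdot (a (x u)) u.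
  by move=> u; have [] := h u.
elim: ax => [|t {}x t0 _ h|{}x z _ hx _ hz|{}x ax h] u.
- by split; [exact: sqnorm_ge0|exact: positive_rdot].
- have [h1 h2] := h u.
  by rewrite bopS bopZ !rdotZl !mulr_ge0.
- have [h1 h2] := hx u; have [h3 h4] := hz u.
  by rewrite -[(x + z : B) u]/(x u + z u) bopD !rdotDl !addr_ge0.
- have [h1 h2] := h u; rewrite bopM; split => //.
  rewrite rdot_sa // -bopM -(power_cone_comm ax (erefl _)) bopM.
  by have [] := h (a u).
Qed.

Variable a : B.

(** The fixed points [b] of the step [b -> (a + b ^ 2) / 2] are those for
    which [(1 - b) ^ 2 = 1 - a]. *)
Fixpoint sqrt_iter n : B :=
  if n is m.+1 then ascale (2^-1)%:C (a + sqrt_iter m * sqrt_iter m) else 0.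

Hypotheses (sa : star a = a) (apos : positive a) (a1 : sqbounded 1 a).

Let half0 : 0 <= 2^-1 :> R. Proof. by rewrite invr_ge0. Qed.

Lemma sqrt_iter_cone n : power_cone a (sqrt_iter n).
Proof.
elim: n => [|n ih] /=.
  by rewrite -(ascale0 1); apply: (@power_coneZ a 0) => //; exact: power_cone1.
apply: power_coneZ => //; apply: power_coneD; last exact: power_cone_mul.
exact: power_cone_id.
Qed.

(** For commuting [p] and [q], [p ^ 2 - q ^ 2 = (p - q) (p + q)]: each increment
    is half the previous one times a sum of two iterates. *)
Lemma sqrt_iter_step n : power_cone a (sqrt_iter n.+1 - sqrt_iter n).
Proof.
elim: n => [|n ih].
  rewrite subr0 /= mulr0 addr0; apply: power_coneZ => //.
  exact: power_cone_id.
have E (p q : B) : p * q = q * p ->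
    ascale (2^-1)%:C (a + p * p) - ascale (2^-1)%:C (a + q * q) =
    ascale (2^-1)%:C ((p - q) * (p + q)).
  move=> pq; apply: (@addIr _ (ascale (2^-1)%:C (a + q * q))).
  rewrite subrK -ascaleDr; congr ascale.
  rewrite addrCA; congr (_ + _).
  by rewrite mulrBl !mulrDr pq opprD addrA addrK subrK.
rewrite -[sqrt_iter n.+2]/(ascale (2^-1)%:C
  (a + sqrt_iter n.+1 * sqrt_iter n.+1)).
rewrite -[in X in _ - X]/(ascale (2^-1)%:C (a + sqrt_iter n * sqrt_iter n)).
rewrite E; last exact: power_coneC (sqrt_iter_cone _) (sqrt_iter_cone _).
apply: power_coneZ => //; apply: power_cone_mul => //.
by apply: power_coneD; exact: sqrt_iter_cone.
Qed.

Lemma sqrt_iter_mono m n : (m <= n)%N -> op_le (sqrt_iter m) (sqrt_iter n).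
Proof.
move=> mn; rewrite -(subnK mn); elim: (n - m)%N => [|k ih].
  rewrite add0n; apply/positiveP; first by rewrite subrr star0.
  by move=> u; rewrite subrr rdot0l.
apply/positiveP => [|u].
  by rewrite starB !(power_cone_sa sa (sqrt_iter_cone _)).
have h1 := positive_rdot u ih.
have step := power_cone_positive sa apos (sqrt_iter_step (k + m)).
have h2 := positive_rdot u step.
rewrite addSn; move: h1 h2; rewrite !bopB !rdotDl !rdotNl; lra.
Qed.

Lemma sqrt_iter_bounded n : sqbounded 1 (sqrt_iter n).
Proof.
elim: n => [|n ih] u.
  by rewrite /= /sqnorm rdot0l mul1r sqnorm_ge0.
rewrite -[sqrt_iter n.+1 u]/((2^-1)%:C *: (a u + sqrt_iter n (sqrt_iter n u))).
rewrite /sqnorm rdotZl rdotZr -/(sqnorm _) -/(sqnorm u) mul1r.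
have := sqnormD_le (a u) (sqrt_iter n (sqrt_iter n u)).
have := a1 u; have := ih u; have := ih (sqrt_iter n u); lra.
Qed.

Lemma sqrt_iter_limit : exists b, [/\ strong_limit sqrt_iter b,
  star b = b & b + b = a + b * b].
Proof.
have iter_sa n := power_cone_sa sa (sqrt_iter_cone n).
have iter1 n : sqbounded (1 ^+ 2) (sqrt_iter n).
  by rewrite expr1n; exact: sqrt_iter_bounded.
have [b hb _] := monotone_strong_limit ltr01 iter_sa iter1 sqrt_iter_mono.
exists b; split=> //; first exact: strong_limit_sa hb iter_sa.
have hb2 : strong_limit (fun n => sqrt_iter n.+1) b.
  by move=> u; have := hb u; rewrite -(@cvg_shiftS H).
have bE : b = ascale (2^-1)%:C (a + b * b).
  apply: strong_limit_unique hb2 _.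
  apply: strong_limitZ; apply: strong_limitD; first exact: strong_limit_cst.
  exact: (strong_limitM iter1 hb hb).
by rewrite {1 2}bE -ascaleDr ascale_half.
Qed.

End square_root.

(** * Closure properties of von Neumann algebras *)

Section von_neumann.
Local Open Scope complex_scope.
Variables (R : realType) (H : hilbertType R) (M : set (boundedOp H)).
Hypothesis vnM : von_neumann_algebra M.
Local Notation B := (boundedOp H).
Implicit Types (x y z : B) (u v : H).

Lemma vnD x y : M x -> M y -> M (x + y).
Proof. by case: vnM => h _ _ _ _; exact: h. Qed.
Lemma vnZ a x : M x -> M (ascale a x).
Proof. by case: vnM => _ h _ _ _; exact: h. Qed.
Lemma vn_mul x y : M x -> M y -> M (x * y).
Proof. by case: vnM => _ _ h _ _; exact: h. Qed.
Lemma vn_star x : M x -> M (star x).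
Proof. by case: vnM => _ _ _ h _; exact: h. Qed.

Lemma vn1 : M 1.
Proof. by case: vnM => _ _ _ _ <- x _; rewrite mulr1 mul1r. Qed.

Lemma vn0 : M 0.
Proof. by rewrite -(ascale0 1); apply: vnZ; exact: vn1. Qed.

Lemma vnB x y : M x -> M y -> M (x - y).
Proof. by move=> Mx My; apply: vnD => //; rewrite bop_opp; exact: vnZ. Qed.

(** The bicommutant is strongly closed, as commutation with a fixed operator
    passes to strong limits. *)
Lemma vn_strong_limit (x_ : nat -> B) x :
  (forall n, M (x_ n)) -> strong_limit x_ x -> M x.
Proof.
move=> Mx hx; case: vnM => _ _ _ _ <- y My.
have h1 := strong_limit_mull (y := y) hx.
have E : (fun n => y * x_ n) = (fun n => x_ n * y).
  by apply/funext => n; rewrite My.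
rewrite E in h1; exact: strong_limit_unique h1 (strong_limit_mulr (y := y) hx).
Qed.

(** With [a = w^* w] and [b] the fixed point of [b -> (a + b ^ 2) / 2] built
    above, [1 - b] is a square root of [1 - a]; it lies in [M] because all
    iterates do. *)
Lemma contraction_defect w : M w -> sqbounded 1 w ->
  exists s, [/\ M s, star s = s & s * s = 1 - star w * w].
Proof.
move=> Mw w1; pose a := star w * w.
have sa : star a = a by rewrite /a starM starK.
have apos : positive a by exact: positive_starM.
have a1 : sqbounded 1 a.
  move=> u; rewrite mul1r /a bopM.
  (* With [v = w^* w u], [sqnorm v = rdot (w v) (w u)]. *)
  set v := star w (w u); have h := rdot_CS (w v) (w u).
  have vE : rdot (w v) (w u) = sqnorm v by rewrite rdot_star.
  rewrite vE in h; have h1 := w1 v; have h2 := w1 u; rewrite !mul1r in h1 h2.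
  have v0 := sqnorm_ge0 v; have wv0 := sqnorm_ge0 (w v).
  have u0 := sqnorm_ge0 u; have wu0 := sqnorm_ge0 (w u).
  have [->|vn0] := eqVneq (sqnorm v) 0 => //.
  have v1 : 0 < sqnorm v by rewrite lt_neqAle eq_sym vn0.
  rewrite -(ler_pM2l v1) -expr2; apply: le_trans h _.
  exact: ler_pM.
have Ma : M a by apply: vn_mul => //; exact: vn_star.
have [b [hb sb bE]] := sqrt_iter_limit sa apos a1.
have Mb : M b.
  apply: vn_strong_limit hb; elim=> [|n ih] /=; first exact: vn0.
  by apply: vnZ; apply: vnD => //; exact: vn_mul.
exists (1 - b); split; first exact: vnB vn1 Mb.
  by rewrite starB star1 sb.
rewrite mulrBl mul1r mulrBr mulr1 opprB addrA.
have -> : b * b = b + b - a by rewrite bE addrC addKr.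
rewrite -/a -[b + b - a]addrA (addrA (1 - b)) subrK -addrA.
by rewrite addrAC subrr sub0r.
Qed.

(** Rescale [w] to a contraction. *)
Lemma bounded_defect r w : M w -> 0 < r -> sqbounded r w ->
  exists s, [/\ M s, star s = s & s * s = ascale r%:C 1 - star w * w].
Proof.
move=> Mw r0 wr; pose q := Num.sqrt r.
have q0 : 0 < q by rewrite sqrtr_gt0.
have qq : q * q = r by rewrite -expr2 sqr_sqrtr // ltW.
have qE : q%:C * q%:C = r%:C by rewrite -rmorphM qq.
have qV : q * q^-1 = 1 by rewrite mulfV ?gt_eqF.
have [||s [Ms ss sE]] := @contraction_defect (ascale (q^-1)%:C w).
- exact: vnZ.
- move=> u; rewrite mul1r bopS /sqnorm rdotZl rdotZr.
  rewrite -(ler_pM2l q0) !mulrA qV mul1r -(ler_pM2l q0) !mulrA qV mul1r qq.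
  exact: wr.
exists (ascale q%:C s); split; [exact: vnZ|by rewrite star_realZ ss|].
rewrite -ascaleAl -ascaleAr ascaleA qE sE star_realZ -ascaleAl -ascaleAr.
rewrite ascaleDr; congr (_ + _).
have E : r%:C * (q^-1)%:C * (q^-1)%:C = 1 :> R[i].
  by rewrite -!rmorphM -qq -mulrA mulrACA qV mulr1.
rewrite !bop_opp !ascaleA; congr ascale.
by rewrite ?mulrA mulrN1 !mulNr E.
Qed.

End von_neumann.

(** * Normal homomorphisms are positive and contractive *)

Section star_homomorphisms.
Local Open Scope complex_scope.
Variables (R : realType) (H : hilbertType R) (M : set (boundedOp H)).
Hypothesis vnM : von_neumann_algebra M.
Local Notation B := (boundedOp H).
Implicit Types (x y : B) (f : B -> B).

Let MZ := @vnZ _ _ _ vnM.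
Let MM := @vn_mul _ _ _ vnM.
Let Mstar := @vn_star _ _ _ vnM.

Lemma star_hom0 f : star_homomorphism M M f -> f 0 = 0.
Proof.
by case=> _ _ fZ _ _; have := fZ 0 0 (vn0 vnM); rewrite !ascale0.
Qed.

Lemma star_homB f x y : star_homomorphism M M f -> M x -> M y ->
  f (x - y) = f x - f y.
Proof.
case=> _ fD fZ _ _ Mx My; rewrite !bop_opp fD // ?fZ //; exact: MZ.
Qed.

Lemma star_hom_iter n f :
  star_homomorphism M M f -> star_homomorphism M M (iter n f).
Proof.
move=> [fM fD fZ fMul fS]; elim: n => [|n [gM gD gZ gMul gS]]; first by split.
split=> [x|x y|a x|x y|x] *; [exact/fM/gM| | | |];
  by rewrite /= ?(gD, gZ, gMul, gS) // ?(fD, fZ, fMul, fS) //; exact: gM.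
Qed.

(** The supremum of the two-element set of [0] and a positive [x] is [x];
    normality turns this into an inequality between [f 0] and [f x]. *)
Lemma normal_positive f x : star_homomorphism M M f -> normal M f ->
  M x -> positive x -> positive (f x).
Proof.
move=> fhom fnormal Mx xpos.
have xx : op_le x x by move=> u; rewrite subrr inner0l.
have zx : op_le 0 x by rewrite /op_le subr0.
have [_ le_fx _] : is_supremum M (f @` [set 0; x]) (f x).
  apply: fnormal.
  - move=> _ [->|->]; split => //; first exact: vn0.
    by move=> u; rewrite inner0l.
  - split; first by exists x; right.
    by move=> y z yD zD; exists x; split; [right|case: yD => ->|case: zD => ->].
  - split => //; first by move=> y [->|->].
    by move=> z Mz; apply; right.
have := le_fx 0; rewrite /op_le subr0; apply.
by exists 0; [left|exact: star_hom0].
Qed.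

(** Apply [f] to the positive element [r 1 - x^* x]. *)
Lemma positive_contractive f r x : star_homomorphism M M f -> f 1 = 1 ->
  (forall y, M y -> positive y -> positive (f y)) ->
  M x -> sqbounded r x -> sqbounded r (f x).
Proof.
move=> fhom f1 fpos Mx /sqbounded_positive h; apply/sqbounded_positive.
have M1 := vn1 vnM; case: (fhom) => _ _ fZ fMul fS.
have := fpos _ _ h; rewrite star_homB // ?fZ // ?fMul // ?fS // ?f1; last first.
- exact/MM/Mx/Mstar.
- exact: MZ.
- exact: Mstar.
by apply; apply: vnB => //; [exact: MZ|exact/MM/Mx/Mstar].
Qed.

End star_homomorphisms.

(** * Projections and order *)

Section projections.
Variables (R : realType) (H : hilbertType R).
Local Notation B := (boundedOp H).
Implicit Types (p x y : B).

Lemma projection_sqnorm p u : p * p = p -> star p = p ->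
  sqnorm (p u) = rdot (p u) u.
Proof. by move=> pp sp; rewrite /sqnorm -{2}sp -rdot_star -bopM pp. Qed.

Lemma projection_bounded p : p * p = p -> star p = p -> sqbounded 1 p.
Proof.
move=> pp sp u; rewrite mul1r.
have := rdot_le_sqnorm (p u) u; rewrite -projection_sqnorm //; lra.
Qed.

Lemma projection_positive p : p * p = p -> star p = p -> positive p.
Proof.
move=> pp sp; apply/positiveP => // u.
by rewrite -projection_sqnorm ?sqnorm_ge0.
Qed.

(** A positive [z] satisfies [z ^ 2 <= q z] for some [q], so a vanishing form
    forces [z = 0]. *)
Lemma op_le_antisym x y :
  star x = x -> star y = y -> op_le x y -> op_le y x -> x = y.
Proof.
move=> sx sy xy yx; apply/eqP; rewrite eq_sym -subr_eq0; apply/eqP/bopP => u.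
apply: sqnorm_eq0; apply/eqP; rewrite eq_le sqnorm_ge0 andbT.
have [r r0 hr] := sqbounded_exists (y - x).
have q0 : 0 < Num.sqrt r by rewrite sqrtr_gt0.
have sq : sqbounded (Num.sqrt r ^+ 2) (y - x) by rewrite sqr_sqrtr // ltW.
have szyx : star (y - x) = y - x by rewrite starB sx sy.
apply: le_trans (positive_sqnorm_le u szyx xy q0 sq) _.
rewrite pmulr_rle0 //.
by have := positive_rdot u yx; rewrite -opprB bopN rdotNl oppr_ge0.
Qed.

Lemma strong_limit_eventually (x_ : nat -> B) x y N :
  strong_limit x_ x -> (forall n, (N <= n)%N -> x_ n = y) -> x = y.
Proof.
move=> hx xy; apply: bopP => u.
apply: cvg_unique (hx u) _ => //; apply: cvg_near_cst.
by exists N => // n /= Nn; rewrite xy.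
Qed.

End projections.

(** * The kernel projections and the decomposition *)

Section kernel_projections.
Local Open Scope complex_scope.
Variables (R : realType) (H : hilbertType R) (M : set (boundedOp H)).
Hypothesis vnM : von_neumann_algebra M.
Local Notation B := (boundedOp H).
Implicit Types (x y z : B) (u v : H) (r : R).

Let MD := @vnD _ _ _ vnM.
Let MZ := @vnZ _ _ _ vnM.
Let MM := @vn_mul _ _ _ vnM.
Let Mstar := @vn_star _ _ _ vnM.
Let MB := @vnB _ _ _ vnM.
Let M1 := vn1 vnM.
Let Mstar_mul x : M x -> M (star x * x).
Proof. by move=> Mx; apply: MM => //; exact: Mstar. Qed.

Variable alpha : B -> B.
Hypotheses (alpha_hom : star_homomorphism M M alpha)
  (alpha_unital : alpha 1 = 1) (alpha_surj : set_surj M M alpha)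
  (alpha_normal : normal M alpha).

Let ihom n : star_homomorphism M M (iter n alpha).
Proof. exact: star_hom_iter. Qed.
Let iter_in n x : M x -> M (iter n alpha x).
Proof. by case: (ihom n) => h *; exact: h. Qed.
Let iter_add n x y : M x -> M y ->
  iter n alpha (x + y) = iter n alpha x + iter n alpha y.
Proof. by case: (ihom n) => _ h *; exact: h. Qed.
Let iter_scale n a x : M x ->
  iter n alpha (ascale a x) = ascale a (iter n alpha x).
Proof. by case: (ihom n) => _ _ h *; exact: h. Qed.
Let iter_mul n x y : M x -> M y ->
  iter n alpha (x * y) = iter n alpha x * iter n alpha y.
Proof. by case: (ihom n) => _ _ _ h *; exact: h. Qed.
Let iter_star n x : M x -> iter n alpha (star x) = star (iter n alpha x).
Proof. by case: (ihom n) => _ _ _ _ h; exact: h. Qed.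
Let iter_sub n x y : M x -> M y ->
  iter n alpha (x - y) = iter n alpha x - iter n alpha y.
Proof. by move=> *; exact: star_homB (ihom n) _ _. Qed.
Let iter0 n : iter n alpha 0 = 0. Proof. exact: star_hom0 (ihom n). Qed.
Let iter1 n : iter n alpha 1 = 1. Proof. by elim: n => //= n ->. Qed.

Let iter_surj n y : M y -> exists2 x, M x & iter n alpha x = y.
Proof.
elim: n y => [|n ih] y My; first by exists y.
have [z Mz <-] := alpha_surj My; have [x Mx <-] := ih _ Mz.
by exists x.
Qed.

Lemma iter_contractive n r x :
  M x -> sqbounded r x -> sqbounded r (iter n alpha x).
Proof.
move=> Mx xr; elim: n => // n ih.
apply: (positive_contractive (f := alpha) vnM) => //; last exact: iter_in.
by move=> y; exact: normal_positive.
Qed.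

Variable e : nat -> B.
Hypothesis he : forall n,
  central_projection M (e n) /\ kernel M (iter n alpha) = ideal_of M (e n).

Let Me n : M (e n). Proof. by have [[]] := he n. Qed.
Let ee n : e n * e n = e n. Proof. by have [[]] := he n. Qed.
Let se n : star (e n) = e n. Proof. by have [[]] := he n. Qed.
Let eC n x : M x -> e n * x = x * e n.
Proof. by have [[_ _ _ h] _] := he n; exact: h. Qed.

Lemma ker_iterP n x : M x -> iter n alpha x = 0 <-> e n * x = x.
Proof.
move=> Mx; have [_ kE] := he n; split=> [x0|<-].
  have : kernel M (iter n alpha) x by split.
  by rewrite kE => -[y My <-]; rewrite mulrA ee.
have : ideal_of M (e n) (e n * x) by exists x.
by rewrite -kE => -[].
Qed.

Lemma kernelP y : kernel M alpha y <-> M y /\ e 1 * y = y.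
Proof.
by split=> -[My h]; split=> //; [apply/(ker_iterP 1)|apply/(ker_iterP 1 My)].
Qed.

Lemma kernel_proj0 : e 0 = 0.
Proof. by apply: ((ker_iterP 0 (Me 0)).2); exact: ee. Qed.

Lemma iter_proj0 n : iter n alpha (e n) = 0.
Proof. by apply/ker_iterP => //; exact: ee. Qed.

Lemma proj_mulS n : e n.+1 * e n = e n.
Proof.
apply/ker_iterP => //=; rewrite iter_proj0; exact: star_hom0 alpha_hom.
Qed.

Lemma proj_mul m n : (m <= n)%N -> e n * e m = e m.
Proof.
move=> mn; apply/ker_iterP => //.
by rewrite -(subnK mn) iterD iter_proj0 iter0.
Qed.

(** Both sides are central projections generating [ker (alpha ^ n)]; for
    [alpha (e n.+1)] this uses surjectivity. *)
Lemma alpha_proj n : alpha (e n.+1) = e n.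
Proof.
have Mp : M (alpha (e n.+1)) by exact: (iter_in 1).
have h1 : e n * alpha (e n.+1) = alpha (e n.+1).
  by apply/ker_iterP => //; rewrite -iterSr iter_proj0.
have [t Mt tE] := alpha_surj (Me n).
have h2 : e n.+1 * t = t.
  by apply/ker_iterP => //; rewrite iterSr tE iter_proj0.
have h3 : alpha (e n.+1) * e n = e n.
  by rewrite -tE -(iter_mul 1) //= h2.
by rewrite -h1 eC.
Qed.

Lemma iter_proj k n : iter k alpha (e (k + n)) = e n.
Proof. by elim: k n => // k ih n; rewrite addSn -addnS iterS ih alpha_proj. Qed.

Lemma proj_le m n : (m <= n)%N -> op_le (e m) (e n).
Proof.
move=> mn; apply: projection_positive; last by rewrite starB !se.
rewrite mulrBl !mulrBr !ee proj_mul // -(eC n (Me m)) proj_mul //.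
by rewrite subrr subr0.
Qed.

Lemma proj_increment m n u : (m <= n)%N ->
  sqnorm (e n u - e m u) = sqnorm (e n u) - sqnorm (e m u).
Proof.
move=> mn; rewrite !projection_sqnorm // -bopB projection_sqnorm.
- by rewrite bopB rdotDl rdotNl.
- rewrite mulrBl !mulrBr !ee proj_mul // -(eC n (Me m)) proj_mul //.
  by rewrite subrr subr0.
- by rewrite starB !se.
Qed.

Lemma proj_bounded n : sqbounded 1 (e n).
Proof. exact: projection_bounded. Qed.

Lemma proj_limit_exists : exists c, strong_limit e c.
Proof.
have e1 n : sqbounded (1 ^+ 2) (e n) by rewrite expr1n; exact: proj_bounded.
by have [c hc _] := monotone_strong_limit ltr01 se e1 proj_le; exists c.
Qed.

Variable c : B.
Hypothesis hc : strong_limit e c.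

Lemma limit_in : M c. Proof. exact: vn_strong_limit hc. Qed.

Lemma limit_mul_proj n : c * e n = e n.
Proof.
apply: (strong_limit_eventually (strong_limit_mulr (y := e n) hc)).
by move=> m; exact: proj_mul.
Qed.

Lemma limit_central x : M x -> c * x = x * c.
Proof.
move=> Mx; have h := strong_limit_mulr (y := x) hc.
have E : (fun n => e n * x) = (fun n => x * e n).
  by apply/funext => n; exact: eC.
by rewrite E in h; exact: strong_limit_unique h (strong_limit_mull (y := x) hc).
Qed.

Lemma limit_idem : c * c = c.
Proof.
have h := strong_limit_mull (y := c) hc.
have E : (fun n => c * e n) = e by apply/funext => n; exact: limit_mul_proj.
by rewrite E in h; exact: strong_limit_unique h hc.
Qed.

Lemma limit_sa : star c = c. Proof. exact: strong_limit_sa hc se. Qed.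

Lemma limit_ge n : op_le (e n) c.
Proof.
have Mc := limit_in.
apply: projection_positive; last by rewrite starB limit_sa se.
rewrite mulrBl !mulrBr ee limit_mul_proj limit_idem -limit_central //.
by rewrite limit_mul_proj subrr subr0.
Qed.

Lemma limit_le z : (forall n, op_le (e n) z) -> op_le c z.
Proof.
move=> ez; apply/positiveE => u; split.
  (* Since [e 0 = 0], [z] itself is positive, so its form is real. *)
  have /positiveE /(_ u) [] := ez 0.
  rewrite kernel_proj0 subr0 bopB innerBl raddfB /=.
  by rewrite (selfadjoint_Im u limit_sa) subr0.
rewrite bopB rdotDl rdotNl subr_ge0.
apply: (cvgr_to_le (cvg_rdot u (@hc u))); near=> n.
by have := positive_rdot u (ez n); rewrite bopB rdotDl rdotNl subr_ge0.
Unshelve. all: by end_near. Qed.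

(** [c] is the supremum of the range of [e], and [alpha] maps this range onto
    itself; by normality [alpha c] is a supremum of the same set. *)
Lemma alpha_limit : alpha c = c.
Proof.
have Mc := limit_in.
have imE : alpha @` range e = range e.
  apply/seteqP; split=> [_ [_ [n _ <-] <-]|_ [n _ <-]].
    case: n => [|n]; last by exists n => //; rewrite alpha_proj.
    by exists 0%N => //; rewrite kernel_proj0; symmetry; exact: (iter0 1).
  by exists (e n.+1); [exists n.+1|exact: alpha_proj].
have sup_c : is_supremum M (range e) c.
  split=> //; first by move=> _ [n _ <-]; exact: limit_ge.
  by move=> z Mz ez; apply: limit_le => n; apply: ez; exists n.
have [_ le_ac ac_le] : is_supremum M (range e) (alpha c).
  rewrite -{1}imE; apply: alpha_normal => //.
    by move=> _ [n _ <-]; split => //; exact: projection_positive.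
  split=> [|_ _ [m _ <-] [n _ <-]]; first by exists (e 0), 0%N.
  exists (e (maxn m n)); split; first by exists (maxn m n).
    by apply: proj_le; exact: leq_maxl.
  by apply: proj_le; exact: leq_maxr.
case: sup_c => _ le_c c_le.
apply: op_le_antisym; last by apply: c_le => //; exact: (iter_in 1).
- by rewrite -(iter_star 1) // limit_sa.
- exact: limit_sa.
- by apply: ac_le.
Qed.

Let Mc : M c. Proof. exact: limit_in. Qed.
Let M1c : M (1 - c). Proof. exact: MB. Qed.

Lemma corner_mul_limit : (1 - c) * c = 0.
Proof. by rewrite mulrBl mul1r limit_idem subrr. Qed.

Lemma corner_central : central_projection M (1 - c).
Proof.
split=> //.
- by rewrite mulrBr mulr1 corner_mul_limit subr0.
- by rewrite starB star1 limit_sa.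
- by move=> x Mx; rewrite mulrBl mulrBr mul1r mulr1 limit_central.
Qed.

Lemma cornerP x : ideal_of M (1 - c) x <-> M x /\ c * x = 0.
Proof.
split=> [[y My <-]|[Mx cx]].
  by split; [exact: MM|rewrite mulrA mulrBr mulr1 limit_idem subrr mul0r].
by exists x => //; rewrite mulrBl mul1r cx subr0.
Qed.

(** Injectivity holds because the kernel of [alpha] lies under [e 1], hence
    under [c]; surjectivity because [alpha] fixes [1 - c], so that a preimage
    in [M] may be cut down by [1 - c]. *)
Lemma corner_automorphism : star_automorphism (ideal_of M (1 - c)) alpha.
Proof.
have [aM aD aZ aMul aS] := alpha_hom.
have ac x : M x -> c * x = 0 -> c * alpha x = 0.
  by move=> Mx cx; rewrite -alpha_limit -(iter_mul 1) // cx; exact: (iter0 1).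
split; first split.
- by move=> x /cornerP[Mx cx]; apply/cornerP; split; [exact: aM|exact: ac].
- by move=> x y /cornerP[Mx _] /cornerP[My _]; exact: aD.
- by move=> a x /cornerP[Mx _]; exact: aZ.
- by move=> x y /cornerP[Mx _] /cornerP[My _]; exact: aMul.
- by move=> x /cornerP[Mx _]; exact: aS.
split.
- by move=> x /cornerP[Mx cx]; apply/cornerP; split; [exact: aM|exact: ac].
- move=> x y; rewrite !inE => /cornerP[Mx cx] /cornerP[My cy] xy.
  apply/eqP; rewrite -subr_eq0; apply/eqP.
  have : e 1 * (x - y) = x - y.
    by apply/(ker_iterP 1); [exact: MB|rewrite iter_sub //= xy subrr].
  move=> <-; rewrite -(limit_mul_proj 1) limit_central // -mulrA mulrBr cx cy.
  by rewrite subrr mulr0.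
- move=> y /cornerP[My cy]; have [x Mx xy] := alpha_surj My.
  exists ((1 - c) * x); first by exists x.
  rewrite -[alpha _]/(iter 1 alpha _) iter_mul // iter_sub // iter1 /=.
  by rewrite alpha_limit xy mulrBl mul1r cy subr0.
Qed.

(** [alpha ^ k] maps the corner of [e k.+1 - e k] isomorphically onto the
    kernel of [alpha]. That its inverse preserves norm bounds follows as for
    [alpha] itself once the inverse is known to preserve positivity, and this
    holds since positive elements have square roots. *)
Lemma bounded_lift k r y : kernel M alpha y -> 0 < r -> sqbounded r y ->
  exists x, [/\ M x, (e k.+1 - e k) * x = x, iter k alpha x = y &
    sqbounded r x].
Proof.
move=> /kernelP[My ey] r0 yr; set d := e k.+1 - e k.
have Md : M d by exact: MB.
have dd : d * d = d.
  rewrite mulrBl !mulrBr !ee proj_mulS -(eC k.+1 (Me k)) proj_mulS.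
  by rewrite subrr subr0.
have sd : star d = d by rewrite starB !se.
have dC z : M z -> d * z = z * d.
  by move=> Mz; rewrite mulrBl mulrBr !eC.
have ad : iter k alpha d = e 1.
  by rewrite iter_sub // iter_proj0 -addn1 iter_proj subr0.
have inj z : M z -> d * z = z -> iter k alpha z = 0 -> z = 0.
  move=> Mz dz /(ker_iterP _ Mz) kz.
  by rewrite -dz -kz mulrA mulrBl proj_mulS ee subrr mul0r.
have [t Mt tE] := iter_surj k My.
pose x := d * t.
have Mx : M x by exact: MM.
have dx : d * x = x by rewrite /x mulrA dd.
have xE : iter k alpha x = y by rewrite iter_mul // ad tE.
have [s [Ms ss sE]] := bounded_defect vnM My r0 yr.
have [q Mq qE] := iter_surj k Ms.
have Mxx := Mstar_mul Mx; have Mqq := Mstar_mul Mq.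
have Mr : M (ascale r%:C 1) by exact: MZ.
(* Both sides lie under [d] and have image [e 1 * (s * s)]. *)
have key : d * (ascale r%:C 1 - star x * x) = d * (star q * q).
  apply/eqP; rewrite -subr_eq0; apply/eqP; apply: inj.
  - by apply: MB; apply: MM => //; exact: MB.
  - by rewrite mulrBr !mulrA dd.
  - rewrite iter_sub; [|by apply: MM => //; exact: MB|exact: MM].
    rewrite !(iter_mul k Md) //; last exact: MB.
    rewrite (iter_sub k Mr Mxx) !iter_mul ?iter_star ?iter_scale //;
      try exact: Mstar.
    by rewrite iter1 xE qE ad tE ey -sE ss subrr.
(* Evaluate [key] at [d u]: the right-hand side is positive. *)
have dw w u : M w -> rdot ((d * w : B) u) u = rdot (w (d u)) (d u).
  move=> Mw; have -> : d * w = d * (w * d) by rewrite -dC // mulrA dd.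
  by rewrite bopM rdot_sa.
exists x; split => // u.
have xd : x (d u) = x u by rewrite -bopM -dC // dx.
have := positive_rdot (d u) (positive_starM q).
rewrite -dw // -key dw; last exact: MB.
rewrite rdot_defect xd subr_ge0 => /le_trans; apply.
rewrite ler_pM2l //.
by have := projection_bounded dd sd u; rewrite mul1r.
Qed.

(** [s] is the strong sum of the lifts of the [y k]. These are uniformly bounded
    and live under the mutually orthogonal projections [e k.+1 - e k], so the
    partial sums obey the same bound and converge along with [e n]. *)
Lemma bounded_gluing r (y : nat -> B) : 0 < r ->
  (forall k, kernel M alpha (y k)) -> (forall k, sqbounded r (y k)) ->
  exists s, [/\ M s, c * s = s & forall k, e 1 * iter k alpha s = y k].
Proof.
move=> r0 Ky yr.
have /choice[x_ hx] := fun k => bounded_lift k (Ky k) r0 (@yr k).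
have Mx k : M (x_ k) by have [] := hx k.
pose s_ n := \sum_(k < n) x_ k.
have sS n : s_ n.+1 = s_ n + x_ n by rewrite /s_ big_ord_recr.
have Ms n : M (s_ n).
  elim: n => [|n ih]; first by rewrite /s_ big_ord0; exact: vn0.
  by rewrite sS; exact: MD.
have ed k : e k * (e k.+1 - e k) = 0.
  by rewrite mulrBr (eC _ (Me _)) proj_mulS ee subrr.
have ex k : e k * x_ k = 0.
  by have [_ <- _ _] := hx k; rewrite mulrA ed mul0r.
have exS k : e k.+1 * x_ k = x_ k.
  have [_ dx _ _] := hx k.
  by rewrite -{1}dx mulrA mulrBr ee proj_mulS.
have es n : e n * s_ n = s_ n.
  elim: n => [|n ih]; first by rewrite /s_ big_ord0 mulr0.
  by rewrite sS mulrDr exS -{1}ih mulrA proj_mulS ih.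
have es_le m n : (m <= n)%N -> e m * s_ n = s_ m.
  move=> mn; rewrite -(subnK mn); elim: (n - m)%N => [|k ih].
    by rewrite add0n es.
  rewrite addSn sS mulrDr ih.
  have -> : e m * x_ (k + m) = 0; last by rewrite addr0.
  by rewrite -(proj_mul (leq_addl k m)) (eC _ (Me m)) -mulrA ex mulr0.
have s_le n u : sqnorm (s_ n u) <= r * sqnorm (e n u).
  elim: n => [|n ih].
    by rewrite /s_ big_ord0 /sqnorm rdot0l mulr_ge0 ?sqnorm_ge0 // ltW.
  (* [s_ n] lives under [e n], and [x_ n] under [e n.+1 - e n]. *)
  have orth : rdot (s_ n u) (x_ n u) = 0.
    by rewrite -es bopM (rdot_sa _ _ (se n)) -bopM ex rdotC rdot0l.
  rewrite sS -[(s_ n + x_ n : B) u]/(s_ n u + x_ n u) /sqnorm !rdotDl !rdotDr.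
  rewrite (rdotC (x_ n u)) orth addr0 add0r -/(sqnorm _) -/(sqnorm (x_ n u)).
  have xu : x_ n u = x_ n (e n.+1 u - e n u).
    rewrite -bopB -bopM; have [_ dx _ _] := hx n.
    by rewrite mulrBr -!eC // mulrBl in dx *; rewrite dx.
  have [_ _ _ /(_ (e n.+1 u - e n u))] := hx n.
  by rewrite -xu proj_increment //; lra.
have [||s hs _] := @strong_limit_exists _ _ r s_ (ltW r0).
- move=> n u; apply: le_trans (s_le n u) _; rewrite ler_wpM2l ?(ltW r0) //.
  by have := proj_bounded n u; rewrite mul1r.
- move=> u; apply: (@cvg_of_increments _ _ _
    (fun n => r * sqnorm (e n u)) (r * sqnorm u)).
    move=> m n mn; rewrite -mulrBr -proj_increment //.
    have -> : s_ n u - s_ m u = s_ n (u - e m u).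
      by rewrite bop_map_sub -bopM -(eC _ (Ms n)) es_le.
    apply: le_trans (s_le _ _) _.
    by rewrite bop_map_sub -bopM proj_mul.
  move=> n; rewrite ler_wpM2l ?(ltW r0) //.
  by have := proj_bounded n u; rewrite mul1r.
have Mslim : M s by exact: vn_strong_limit hs.
have eslim m : e m * s = s_ m.
  apply: (strong_limit_eventually (strong_limit_mull (y := e m) hs)) => n.
  exact: es_le.
exists s; split=> // [|k].
  have h := strong_limit_mulr (y := s) hc.
  have E : (fun n => e n * s) = s_ by apply/funext.
  by rewrite E in h; exact: strong_limit_unique h hs.
have [_ _ xy _] := hx k; have [My ey] := (kernelP _).1 (Ky k).
rewrite -(iter_proj k 1) -iter_mul // addn1 eslim sS iter_add // xy.
by rewrite (_ : iter k alpha (s_ k) = 0) ?add0r //; apply/ker_iterP.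
Qed.

(** The [k]-th entry records the part of [x] under [e k.+1 - e k], transported
    by [alpha ^ k] to the kernel of [alpha]. *)
Definition shift_coordinates x : B * (nat -> B) :=
  ((1 - c) * x, fun k => e 1 * iter k alpha x).

Let K := kernel M alpha.

Let Kmul x : M x -> K (e 1 * x).
Proof. by move=> Mx; apply/kernelP; split; [exact: MM|rewrite mulrA ee]. Qed.

(** If all coordinates of [x] vanish, then [e k.+1 * x] lies in the kernel of
    [alpha ^ k], so that [e k.+1 * x = e k * x] for all [k]; since
    [e 0 = 0], all [e k * x] vanish, and with them [c * x]. *)
Lemma shift_coordinates_eq0 x : M x -> (1 - c) * x = 0 ->
  (forall k, e 1 * iter k alpha x = 0) -> x = 0.
Proof.
move=> Mx cx xk.
have ex n : e n * x = 0.
  elim: n => [|n ih]; first by rewrite kernel_proj0 mul0r.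
  have Mex : M (e n.+1 * x) by exact: MM.
  have /(ker_iterP n Mex) <- : iter n alpha (e n.+1 * x) = 0.
    by rewrite iter_mul // -addn1 iter_proj.
  by rewrite mulrA (eC _ (Me _)) proj_mulS.
have -> : x = c * x by apply/eqP; rewrite -subr_eq0 -{1}(mul1r x) -mulrBl cx.
have cx_lim := strong_limit_mulr (y := x) hc.
apply: (strong_limit_eventually (N := 0) cx_lim) => n _.
exact: ex.
Qed.

Lemma shift_coordinates_hom :
  star_homomorphism M (ideal_of M (1 - c) `*` linfty K) shift_coordinates.
Proof.
have [_ idc sc Cc] := corner_central.
split.
- move=> x Mx; split; first by exists x.
  split=> [k|]; first by apply: Kmul; exact: iter_in.
  have [r r0 xr] := sqbounded_exists x.
  exists (Num.sqrt r) => k u.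
  rewrite normr_le_sqnorm ?sqrtr_ge0 // sqr_sqrtr ?(ltW r0) // bopM.
  apply: le_trans (proj_bounded 1 _) _; rewrite mul1r.
  exact: iter_contractive.
- move=> x y Mx My; congr pair; first exact: mulrDr.
  by apply/funext => k; rewrite iter_add // mulrDr.
- move=> a x Mx; congr pair; first by rewrite /= -ascaleAr.
  by apply/funext => k; rewrite iter_scale // -ascaleAr.
- move=> x y Mx My; congr pair.
    by rewrite /= -[in LHS]idc -!mulrA; congr (_ * _); rewrite !mulrA Cc.
  apply/funext => k; rewrite iter_mul // -[in LHS](ee 1) -!mulrA; congr (_ * _).
  by rewrite !mulrA eC //; exact: iter_in.
- move=> x Mx; congr pair.
    by rewrite /= Cc; [rewrite starM sc|exact: Mstar].
  apply/funext => k; rewrite -[RHS]/(star (e 1 * iter k alpha x)) starM se.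
  by rewrite iter_star // eC //; apply: Mstar; exact: iter_in.
Qed.

Lemma shift_coordinates_surj :
  set_surj M (ideal_of M (1 - c) `*` linfty K) shift_coordinates.
Proof.
move=> [p y] [/= pP [Ky [t yt]]].
have [Mp cp] := (cornerP p).1 pP.
have r0 : 0 < t ^+ 2 + 1 by rewrite ltr_wpDl ?sqr_ge0.
have yr k : sqbounded (t ^+ 2 + 1) (y k).
  move=> u; apply: le_trans (_ : t ^+ 2 * sqnorm u <= _).
    rewrite -real_normK ?num_real // -normr_le_sqnorm //.
    by apply: le_trans (yt k u) _; rewrite ler_wpM2r // lecR ler_norm.
  by rewrite ler_wpM2r ?sqnorm_ge0 // lerDl.
have [s [Ms cs sk]] := bounded_gluing r0 Ky yr.
exists (p + s); first exact: MD.
congr pair.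
  by rewrite mulrBl mul1r mulrDr cp cs add0r addrK.
apply/funext => k.
have ep : e k.+1 * p = 0.
  by rewrite -(limit_mul_proj k.+1) limit_central // -mulrA cp mulr0.
rewrite iter_add // mulrDr sk -{1}(iter_proj k 1) -iter_mul // addn1 ep.
by rewrite iter0 add0r.
Qed.

Lemma shift_coordinates_conjugate :
  conjugate M alpha (ideal_of M (1 - c) `*` linfty K)
    (direct_sum_map alpha (@backward_shift R H)).
Proof.
exists shift_coordinates; split.
  split; first exact: shift_coordinates_hom.
  split; [by have [] := shift_coordinates_hom| |exact: shift_coordinates_surj].
  move=> x y; rewrite !inE => Mx My xy.
  have xy1 : (1 - c) * x = (1 - c) * y := congr1 fst xy.
  have xy2 k : e 1 * iter k alpha x = e 1 * iter k alpha y.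
    exact: (congr1 (fun q => q.2 k) xy).
  apply/eqP; rewrite -subr_eq0; apply/eqP; apply: shift_coordinates_eq0.
  - exact: MB.
  - by rewrite mulrBr xy1 subrr.
  - by move=> k; rewrite iter_sub // mulrBr xy2 subrr.
move=> x Mx; congr pair.
  rewrite -[RHS]/(iter 1 alpha ((1 - c) * x)) iter_mul // iter_sub // iter1.
  by rewrite /= alpha_limit.
by apply/funext => k; rewrite /backward_shift /= -iterSr.
Qed.

End kernel_projections.

Theorem theorem3p1 (R : realType) (H : hilbertType R) (M : set (boundedOp H))
    (hM : von_neumann_algebra M) (alpha : boundedOp H -> boundedOp H)
    (alpha_hom : star_homomorphism M M alpha)
    (alpha_unital : alpha 1 = 1)
    (alpha_surj : set_surj M M alpha)
    (alpha_normal : normal M alpha)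
    (c_ : nat -> boundedOp H)
    (hc_ : forall n, (0 < n)%N ->
      central_projection M (c_ n) /\
      kernel M (iter n alpha) = ideal_of M (c_ n)) :
  (forall n, (0 < n)%N -> op_le (c_ n) (c_ n.+1)) /\
  exists c : boundedOp H,
    strong_limit c_ c /\
    [/\ central_projection M c,
        alpha c = c,
        star_automorphism (ideal_of M (1 - c)) alpha &
        conjugate M alpha
          (ideal_of M (1 - c) `*` linfty (kernel M alpha))
          (direct_sum_map alpha (@backward_shift R H))].
Proof.
(* [c_ 0] is unconstrained; [0] is the kernel projection of [alpha ^ 0]. *)
pose e n := if n is 0%N then 0 else c_ n.
have M0 := vn0 hM.
have he n : central_projection M (e n) /\
    kernel M (iter n alpha) = ideal_of M (e n).
  case: n => [|n]; last exact: hc_.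
  split; first by split=> [||| x _]; rewrite ?mulr0 ?mul0r ?star0.
  apply/seteqP; split=> x; first by case=> _ /= ->; exists 0; rewrite ?mul0r.
  by case=> y _ <-; rewrite mul0r; split.
split=> [[//|n] _|].
  exact: (proj_le hM alpha_hom he (leqnSn n.+1)).
have [c hc] := proj_limit_exists hM alpha_hom he.
exists c; split.
  move=> u; have h := hc u.
  by rewrite -(@cvg_shiftS H (fun n => e n u)) in h; rewrite -cvg_shiftS.
have Mc := limit_in hM he hc.
split.
- split=> //; first exact: (limit_idem hM alpha_hom he hc).
    exact: (limit_sa he hc).
  exact: (limit_central he hc).
- exact: (alpha_limit hM alpha_hom alpha_surj alpha_normal he hc).
- exact: (corner_automorphism hM alpha_hom alpha_unital alpha_surj
    alpha_normal he hc).
- exact: (shift_coordinates_conjugate hM alpha_hom alpha_unital alpha_surj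
    alpha_normal he hc).
Qed.
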